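(* Let $d\ge2$, $\varphi\in L^1_{loc}(\mathbb{R}^d,dx)$ with $\varphi>0$ $dx$-a.e., $\mu:=\varphi\,dx$, and let $a_{ij}$, $1\le i,j\le d$, be measurable with $a_{ij}=a_{ji}$. Assume the bilinear form $$\mathcal{E}(f,g)=\sum_{i,j=1}^d\int_{\mathbb{R}^d}a_{ij}(x)\partial_if(x)\partial_jg(x)\,\mu(dx),\qquad f,g\in C_0^\infty(\mathbb{R}^d),$$ is well-defined, positive and closable on $L^2(\mathbb{R}^d,\mu)$, with closure $(\mathcal{E},D(\mathcal{E}))$. Suppose there exist a compact set $K\subset\mathbb{R}^d$ and a function $\phi$ on $[0,\infty)$ with $x\mapsto\phi(|x|)$ in $L^1_{loc}(\mathbb{R}^d\setminus K,dx)$ such that $$\|A(x)\|\varphi(x)\le\phi(|x|)\qquad\forall x\in\mathbb{R}^d\setminus K,$$ where $\|A(x)\|=\big(\sum_{i,j=1}^d a_{ij}(x)^2\big)^{1/2}$. Let $\rho>0$ be such that $K\subset B_\rho(0)$ and for $n>\rho$ set $$a_n:=\int_{\overline{B_n(0)}\setminus B_\rho(0)}\frac{|y|^{2-2d}}{\phi(|y|)}\,dy.$$ If $a_n<\infty$ for every $n>\rho$ and $a_n\to\infty$ as $n\to\infty$, then $(\mathcal{E},D(\mathcal{E}))$ is recurrent.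
   Context: $B_r(0)=\{x\in\mathbb{R}^d:|x|<r\}$ and $\overline{B_r(0)}=\{x:|x|\le r\}$, with $|\cdot|$ the Euclidean norm. A closed symmetric form $(\mathcal{E},D(\mathcal{E}))$ on $L^2(\mathbb{R}^d,\mu)$ is called recurrent if there exists $(u_n)_{n\in\mathbb{N}}\subset D(\mathcal{E})$ with $0\le u_n\le1$, $u_n\nearrow1$ $dx$-a.e. as $n\to\infty$, and $\lim_{n\to\infty}\mathcal{E}(u_n,u_n)=0$. *)

(* Defs.v *)
From HB Require Import structures.
From mathcomp Require Import all_boot all_order all_algebra.
From mathcomp Require Import all_classical all_reals all_analysis.
Set Implicit Arguments. Unset Strict Implicit. Unset Printing Implicit Defensive.
Import Order.TTheory GRing.Theory Num.Theory.
Import numFieldNormedType.Exports.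
Local Open Scope classical_set_scope.
Local Open Scope ring_scope.

(** * R^d as 'rV[R]_d, with the Borel (= product) sigma-algebra,
    pulled back from the product sigma-algebra on d.-tuple R. *)
Section rV_meas.
Context {R : realType} {d : nat}.
Definition rv2tup (x : 'rV[R]_d) : d.-tuple R := [tuple x ord0 i | i < d].
HB.instance Definition _ :=
  Measurable.copy 'rV[R]_d (g_sigma_algebra_preimageType rv2tup).
End rV_meas.

Section defs.
Context {R : realType} {d : nat}.
Local Notation Rd := 'rV[R]_d.

(** Euclidean norm |x| (the normed structure of 'rV is the max norm). *)
Definition eucl (x : Rd) : R := Num.sqrt (\sum_(i < d) x ord0 i ^+ 2).

(** Lebesgue measure on R^d: the measure of every closed box is the
    product of its side lengths (this characterizes it on Borel sets). *)
Definition is_lebesgue_measure (lam : {measure set Rd -> \bar R}) : Prop :=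
  forall a b : 'I_d -> R, (forall i, a i <= b i) ->
    lam [set x : Rd | forall i, a i <= x ord0 i <= b i]
      = (\prod_(i < d) (b i - a i))%:E.

Definition loc_integrable_on (lam : {measure set Rd -> \bar R})
    (U : set Rd) (f : Rd -> R) : Prop :=
  forall C : set Rd, compact C -> C `<=` U -> lam.-integrable C (EFin \o f).

Definition e_ (i : 'I_d) : Rd := delta_mx ord0 i.
Definition partial (i : 'I_d) (f : Rd -> R) : Rd -> R :=
  fun x => 'D_(e_ i) f x.

Fixpoint iter_partial (s : seq 'I_d) (f : Rd -> R) : Rd -> R :=
  if s is i :: s' then partial i (iter_partial s' f) else f.

Definition smooth (f : Rd -> R) : Prop :=
  forall s : seq 'I_d, continuous (iter_partial s f) /\
    forall (i : 'I_d) (x : Rd), derivable (iter_partial s f) x (e_ i).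

Definition C0inf (f : Rd -> R) : Prop :=
  smooth f /\ compact (closure [set x | f x != 0]).

Definition dform (lam : {measure set Rd -> \bar R}) (varphi : Rd -> R)
    (a : 'I_d -> 'I_d -> Rd -> R) (f g : Rd -> R) : R :=
  \sum_(i < d) \sum_(j < d)
     Rintegral lam setT
       (fun x => a i j x * partial i f x * partial j g x * varphi x).

Definition L2dist2 (lam : {measure set Rd -> \bar R}) (varphi : Rd -> R)
    (f g : Rd -> R) : \bar R :=
  (\int[lam]_x ((f x - g x) ^+ 2 * varphi x)%:E)%E.

Definition form_cauchy (E : (Rd -> R) -> (Rd -> R) -> R)
    (f : nat -> Rd -> R) : Prop :=
  forall eps : R, 0 < eps -> exists N : nat, forall n m : nat,
    (N <= n)%N -> (N <= m)%N -> E (f n \- f m) (f n \- f m) < eps.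

Definition closable (lam : {measure set Rd -> \bar R}) (varphi : Rd -> R)
    (E : (Rd -> R) -> (Rd -> R) -> R) : Prop :=
  forall f : nat -> Rd -> R, (forall n, C0inf (f n)) ->
    (fun n => L2dist2 lam varphi (f n) (fun _ => 0)) @ \oo --> 0%E ->
    form_cauchy E f ->
    (fun n => E (f n) (f n)) @ \oo --> (0 : R).

(** u belongs to the domain D(E) of the closure of E, and E(u,u) = e. *)
Definition closure_form (lam : {measure set Rd -> \bar R}) (varphi : Rd -> R)
    (E : (Rd -> R) -> (Rd -> R) -> R) (u : Rd -> R) (e : R) : Prop :=
  measurable_fun setT u /\
  exists f : nat -> Rd -> R, (forall n, C0inf (f n)) /\
    (fun n => L2dist2 lam varphi (f n) u) @ \oo --> 0%E /\
    form_cauchy E f /\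
    (fun n => E (f n) (f n)) @ \oo --> e.

Definition recurrent (lam : {measure set Rd -> \bar R}) (varphi : Rd -> R)
    (E : (Rd -> R) -> (Rd -> R) -> R) : Prop :=
  exists (u : nat -> Rd -> R) (e : nat -> R),
    (forall n, closure_form lam varphi E (u n) (e n)) /\
    {ae lam, forall x, forall n, 0 <= u n x <= 1 /\ u n x <= u n.+1 x} /\
    {ae lam, forall x, (fun n => u n x) @ \oo --> (1 : R)} /\
    e @ \oo --> (0 : R).

Definition normA (a : 'I_d -> 'I_d -> Rd -> R) (x : Rd) : R :=
  Num.sqrt (\sum_(i < d) \sum_(j < d) a i j x ^+ 2).

(** a_n = int_{rho <= |y| <= n} |y|^(2-2d) / phi(|y|) dy  (the integrand is
    +oo where phi(|y|) <= 0, i.e. 1/0 = +oo). *)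
Definition a_seq (lam : {measure set Rd -> \bar R}) (phi : R -> R) (rho : R)
    (n : nat) : \bar R :=
  (\int[lam]_(y in [set y : Rd | (rho <= eucl y <= n%:R)%R])
     (if (0 < phi (eucl y))%R then ((eucl y ^- (2 * d - 2)%N) / phi (eucl y))%R%:E
      else +oo))%E.

End defs.

(* Main.v *)
Require Import Defs.
From HB Require Import structures.
From mathcomp Require Import all_boot all_order all_algebra.
From mathcomp Require Import all_classical all_reals all_analysis.
From mathcomp Require Import measurable_realfun zify ring lra.
Import Order.TTheory GRing.Theory Num.Theory.
Import numFieldNormedType.Exports.
Local Open Scope classical_set_scope.
Local Open Scope ring_scope.

(** Only cutoff functions in C_0^infty are used, each approximated by the constant
    sequence.  Since Lebesgue measure scales like r^d, the map x |-> |x|^d pushes it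
    forward to c ds on [0, oo[, with c the volume of the unit ball.  With s = |x|^d the
    integrand |x|^(2-2d)/phi(|x|) of a_n becomes a density on the line; replace phi by
    max(phi, 0) + 1/(m+1) to get a bounded density b, whose integral F over
    ]r0^d, r1^d] is as large as we like, for r0 fixed and r1, m large.  The radial
    function decreasing from 1 to 0 with derivative -b/F in s has energy at most
    d^2 c/F.  To make it smooth, b is replaced by a sum of smooth steps which
    carries on each cell of a grid the exact mass of b: this costs a constant factor,
    because the gradient is then controlled by the cell averages of b, which converge
    to b almost everywhere by Lebesgue differentiation.  Taking each inner
    radius to be the previous outer one makes the cutoffs increase to 1. *)

(** * Smooth functions *)

Section flat.
Context {R : realType}.
Implicit Types (t : R) (m : nat).

(** For [m = 0] this is the classical function e^(-1/t) extended by 0. The factors t^(-m) are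
    included so that the derivative of a member is a linear combination of members, which gives
    derivatives of every order. *)
Definition flat m t : R := if 0 < t then t ^- m * expR (- t^-1) else 0.

Lemma flat_gt0 m t : 0 < t -> 0 < flat m t.
Proof. by move=> t0; rewrite /flat t0 mulr_gt0 ?expR_gt0// invr_gt0 exprn_gt0. Qed.

Lemma flat_ge0 m t : 0 <= flat m t.
Proof. by have [/(flat_gt0 m)/ltW//|t0] := ltP 0 t; rewrite /flat ltNge t0. Qed.

Lemma flat_eq0 m t : t <= 0 -> flat m t = 0.
Proof. by move=> t0; rewrite /flat ltNge t0. Qed.

(** One term of the exponential series gives e^(1/t) >= t^(-m-2)/(m+2)!. A bound of second order at
    0 is what differentiability there requires. *)
Lemma flat_le m t : flat m t <= (m.+2)`!%:R * t ^+ 2.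
Proof.
have [t0|t0] := ltP 0 t; last by rewrite flat_eq0// mulr_ge0// sqr_ge0.
rewrite /flat t0 expRN ler_pdivrMr ?expR_gt0//.
have h : t ^- m.+2 / m.+2`!%:R <= expR t^-1.
  have ti0 : 0 <= t^-1 by rewrite invr_ge0 ltW.
  apply: le_trans (expR_ge1Dxn m.+1 ti0).
  by rewrite exprVn lerDr.
have f0 : 0 < (m.+2)`!%:R :> R by rewrite ltr0n fact_gt0.
rewrite (_ : t ^- m = m.+2`!%:R * t ^+ 2 * (t ^- m.+2 / m.+2`!%:R)).
  by rewrite ler_wpM2l// mulr_ge0// ?ltW// exprn_gt0.
rewrite -addn2 exprD; field.
by rewrite addn2 !gt_eqF ?exprn_gt0.
Qed.

Lemma is_derive_flat m t :
  is_derive t 1 (flat m) (flat m.+2 t - m%:R * flat m.+1 t).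
Proof.
have [t0|t0|t0] := ltgtP t 0.
- rewrite !flat_eq0 ?ltW// mulr0 subr0.
  apply: (@near_eq_is_derive _ _ _ (cst 0)).
  near=> s; rewrite flat_eq0//; near: s.
  apply: filterS (cvgr_lt _ (@cvg_id _ (nbhs t)) _ t0) => ? /ltW; exact.
- apply: (@near_eq_is_derive _ _ _ (fun t => t ^- m * expR (- t^-1))).
    near=> s; rewrite /flat ifT//; near: s.
    exact: (cvgr_gt _ (@cvg_id _ (nbhs t)) _ t0).
  rewrite /flat t0.
  have tN0 : t != 0 by rewrite gt_eqF.
  have HV : is_derive t 1 (fun s => s^-1 : R) (- t ^- 2 *: 1).
    by apply: is_deriveV.
  have HX : is_derive t 1 (fun s => (s ^+ m)^-1 : R) (- (t ^+ m) ^- 2 *: (m%:R * t ^+ m.-1 *: 1)).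
    apply: is_deriveV; first by rewrite expf_neq0.
    have := is_deriveX m (is_derive_id t (1 : R)).
    by congr is_derive; apply/funext => s; rewrite exprfctE.
  have HE : is_derive t 1 (expR \o (fun s => - s^-1)) (expR (- t^-1) * (- (- t ^- 2 *: 1))).
    exact: is_derive1_comp.
  apply: is_derive_eq (is_deriveM HX HE) _.
  rewrite /GRing.scale /=.
  have En : expR (- t^-1) != 0 by rewrite gt_eqF// expR_gt0.
  case: m {HX} => [|n].
    by rewrite !expr0 !mul0r !mulr0 subr0 addr0 invr1 !mul1r mulr1 opprK mulrC.
  by rewrite /= !exprS; field; rewrite tN0 expf_neq0.
(* At the origin [flat_le] bounds the difference quotient by (m+2)! |h|. *)
- rewrite t0 !flat_eq0// mulr0 subr0.
  have C0 : 0 < (m.+2)`!%:R :> R by rewrite ltr0n fact_gt0.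
  have H0 : h^-1 *: ((flat m \o shift 0) (h *: 1) - flat m 0) @[h --> 0^'] --> (0 : R).
    apply/cvgr0Pnorm_le => e e0; near=> h.
    have hN0 : h != 0 by near: h; exact: nbhs_dnbhs_neq.
    have he : `|h| <= e / (m.+2)`!%:R.
      by near: h; apply: dnbhs0_le; rewrite divr_gt0.
    rewrite /= addr0 [h *: 1]mulr1 (@flat_eq0 m 0)// subr0 normrZ normfV.
    rewrite (ger0_norm (flat_ge0 _ _)) ler_pdivrMl ?normr_gt0//.
    apply: le_trans (flat_le _ _) _.
    rewrite -(ger0_norm (sqr_ge0 h)) normrX expr2 mulrCA ler_wpM2l//.
    by rewrite mulrC -ler_pdivlMr.
  split; first by apply/cvg_ex; exists 0.
  by apply: (cvg_lim _ H0).
Unshelve. all: by end_near. Qed.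

Lemma continuous_flat m : continuous (flat m).
Proof.
move=> t; have [dfl _] := is_derive_flat m t.
by apply: differentiable_continuous; apply/derivable1_diffP.
Qed.

End flat.

Section dir.
Context {R : realType} {V : normedModType R}.

(** On the line t |-> x + t v the directional derivative becomes an ordinary derivative at 0, so the
    chain rule in one variable applies. *)
Lemma is_derive_comp (f : V -> R) (g : R -> R) (x v : V) (df dg : R) :
  is_derive x v f df -> is_derive (f x) 1 g dg -> is_derive x v (g \o f) (dg * df).
Proof.
move=> Hf Hg.
have E (h : V -> R) dh :
    is_derive x v h dh <-> is_derive (0 : R) 1 (fun t : R => h (t *: v + x)) dh.
  have EE : (fun t : R => t^-1 *: ((h \o shift x) (t *: v) - h x)) =
      (fun t : R => t^-1 *: (((fun t : R => h (t *: v + x)) \o shift 0) (t *: 1)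
         - h (0 *: v + x))).
    by apply/funext => t /=; rewrite addr0 scale0r add0r [t *: 1]mulr1.
  split => -[H1 H2].
  - by split; [exact: (derivable1P h x v).1 H1|rewrite -H2 /derive EE].
  - by split; [exact: (derivable1P h x v).2 H1|rewrite -H2 /derive EE].
apply/E; move/E : Hf => Hf.
have := @is_derive1_comp R g (fun t : R => f (t *: v + x)) 0 dg df.
rewrite scale0r add0r; exact.
Qed.

End dir.

Section smooth_expr.
Context {R : realType} {d : nat}.
Local Notation Rd := 'rV[R]_d.

(* This class is stable under partial derivatives, so that smoothness of its members
   follows from their continuity and derivability alone. *)
Inductive smooth_expr : (Rd -> R) -> Prop :=
| se_cst c : smooth_expr (fun=> c)
| se_coord i : smooth_expr (fun x => x ord0 i)
| se_add f g : smooth_expr f -> smooth_expr g -> smooth_expr (fun x => f x + g x)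
| se_mul f g : smooth_expr f -> smooth_expr g -> smooth_expr (fun x => f x * g x)
| se_flat m f : smooth_expr f -> smooth_expr (fun x => flat m (f x))
| se_inv f : smooth_expr f -> (forall x, f x != 0) ->
    smooth_expr (fun x => (f x)^-1).

Lemma continuous_smooth_expr f : smooth_expr f -> continuous f.
Proof.
elim=> {f} [c|i|f g _ cf _ cg|f g _ cf _ cg|m f _ cf|f _ cf f0] x.
- exact: cst_continuous.
- exact: coord_continuous.
- exact: (continuousD (cf x) (cg x)).
- exact: (continuousM (cf x) (cg x)).
- exact: (continuous_comp (cf x) (@continuous_flat R m (f x))).
- exact: (continuousV (f0 x) (cf x)).
Qed.

Lemma is_derive_coord (i j : 'I_d) (x : Rd) :
  is_derive x (e_ i) (fun y : Rd => y ord0 j) (j == i)%:R.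
Proof.
have H : (h^-1 *: (((fun y : Rd => y ord0 j) \o shift x) (h *: e_ i) - x ord0 j))
    @[h --> (0 : R)^'] --> ((j == i)%:R : R).
  apply: cvg_near_cst; near=> h.
  have hN0 : h != 0 by near: h; exact: nbhs_dnbhs_neq.
  by rewrite /= !mxE addrK eqxx/= /GRing.scale/= mulKf.
split; first by apply/cvg_ex; exists (j == i)%:R.
by apply: (cvg_lim _ H).
Unshelve. all: by end_near. Qed.

Lemma is_derive_smooth_expr f i : smooth_expr f ->
  exists2 g, smooth_expr g & forall x, is_derive x (e_ i) f (g x).
Proof.
elim=> {f} [c|j|f g sf [f' sf' df] sg [g' sg' dg]|f g sf [f' sf' df] sg [g' sg' dg]
  |m f sf [f' sf' df]|f sf [f' sf' df] f0].
- by exists (fun=> 0); [exact: se_cst|move=> x; exact: is_derive_cst].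
- exists (fun=> (j == i)%:R); first exact: se_cst.
  by move=> x; exact: is_derive_coord.
- exists (fun x => f' x + g' x); first exact: se_add.
  by move=> x; exact: is_deriveD.
- exists (fun x => f x * g' x + g x * f' x).
    by apply: se_add; exact: se_mul.
  by move=> x; exact: is_deriveM.
- exists (fun x => (flat m.+2 (f x) + (- m%:R) * flat m.+1 (f x)) * f' x).
    apply: se_mul => //; apply: se_add; first exact: se_flat.
    by apply: se_mul; [exact: se_cst|exact: se_flat].
  move=> x; apply: is_derive_comp => //.
  by rewrite mulNr; exact: is_derive_flat.
- exists (fun x => (-1 * ((f x)^-1 * (f x)^-1)) * f' x).
    apply: se_mul => //; apply: se_mul; first exact: se_cst.
    by apply: se_mul; exact: se_inv.
  move=> x; have [d1 d2] := df x.
  split; first exact: derivableV.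
  by rewrite deriveV// d2 expr2 invfM mulN1r.
Qed.

Lemma smooth_smooth_expr f : smooth_expr f -> smooth f.
Proof.
move=> sf s; have : smooth_expr (iter_partial s f).
  elim: s => //= i s IH; rewrite /partial.
  have [g sg dg] := is_derive_smooth_expr _ i IH.
  rewrite (_ : (fun _ => _) = g)//; apply/funext => x.
  by have [_] := dg x.
move=> {}sf; split; first exact: continuous_smooth_expr.
move=> i x; have [g _ dg] := is_derive_smooth_expr _ i sf.
by have [] := dg x.
Qed.

Lemma se_opp f : smooth_expr f -> smooth_expr (fun x => - f x).
Proof.
move=> sf; rewrite (_ : (fun _ => _) = fun x => -1 * f x).
  by apply: se_mul => //; exact: se_cst.
by apply/funext => x; rewrite mulN1r.
Qed.

Lemma se_sum (I : Type) (r : seq I) (F : I -> Rd -> R) :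
  (forall i, smooth_expr (F i)) -> smooth_expr (fun x => \sum_(i <- r) F i x).
Proof.
move=> sF; elim: r => [|i r IH].
  by under eq_fun do rewrite big_nil; exact: se_cst.
by under eq_fun do rewrite big_cons; exact: se_add.
Qed.

Lemma se_exp f n : smooth_expr f -> smooth_expr (fun x => f x ^+ n).
Proof.
move=> sf; elim: n => [|n IH]; first exact: se_cst.
by under eq_fun do rewrite exprS; exact: se_mul.
Qed.

End smooth_expr.

(** * A smooth transition from 0 to 1 *)

Section smooth_step.
Context {R : realType}.
Implicit Types t : R.

Definition step t : R := flat 0 t / (flat 0 t + flat 0 (1 - t)).

(** The derivative of [step] by the quotient rule, arranged so that every term is visibly
    nonnegative. *)
Definition dstep t : R :=
  (flat 2 t * flat 0 (1 - t) + flat 0 t * flat 2 (1 - t))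
    / (flat 0 t + flat 0 (1 - t)) ^+ 2.

(** The numbers t and 1 - t are never both nonpositive. *)
Lemma step_den_gt0 t : 0 < flat 0 t + flat 0 (1 - t).
Proof.
have [t0|t0] := ltP 0 t; first by rewrite ltr_pwDl ?flat_gt0 ?flat_ge0.
by rewrite ltr_wpDl ?flat_ge0// flat_gt0//; lra.
Qed.

Lemma step_ge0 t : 0 <= step t.
Proof. by rewrite divr_ge0 ?flat_ge0// ltW// step_den_gt0. Qed.

Lemma step_le1 t : step t <= 1.
Proof. by rewrite ler_pdivrMr ?step_den_gt0// mul1r lerDl flat_ge0. Qed.

Lemma step_eq0 t : t <= 0 -> step t = 0.
Proof. by move=> t0; rewrite /step flat_eq0// mul0r. Qed.

Lemma step_eq1 t : 1 <= t -> step t = 1.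
Proof.
move=> t1; rewrite /step (@flat_eq0 _ _ (1 - t)) ?subr_le0// addr0 divff//.
by rewrite gt_eqF// flat_gt0// (lt_le_trans _ t1).
Qed.

Lemma dstep_out t : ~~ (0 < t < 1) -> dstep t = 0.
Proof.
rewrite negb_and -!leNgt => /orP[t0|t1]; rewrite /dstep.
  by rewrite !(@flat_eq0 _ _ t)// !mul0r addr0 mul0r.
by rewrite !(@flat_eq0 _ _ (1 - t)) ?subr_le0// !mulr0 addr0 mul0r.
Qed.

Lemma dstep_ge0 t : 0 <= dstep t.
Proof. by rewrite divr_ge0 ?sqr_ge0// addr_ge0// mulr_ge0 ?flat_ge0. Qed.

Lemma is_derive_step t : is_derive t 1 step (dstep t).
Proof.
have D0 : flat 0 t + flat 0 (1 - t) != 0 by rewrite gt_eqF// step_den_gt0.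
have H1 := is_derive_flat 0 t; rewrite mul0r subr0 in H1.
have H3 : is_derive t 1 (fun s : R => 1 - s) (0 - 1).
  exact: (is_deriveB (is_derive_cst (1 : R) t 1) (is_derive_id t (1 : R))).
have H2 : is_derive t 1 (flat 0 \o (fun s : R => 1 - s)) (flat 2 (1 - t) * (0 - 1)).
  apply: is_derive1_comp; have := is_derive_flat 0 (1 - t).
  by rewrite mul0r subr0.
have H4 := is_deriveV (f := fun s => flat 0 s + flat 0 (1 - s)) D0 (is_deriveD H1 H2).
apply: is_derive_eq (is_deriveM H1 H4) _.
rewrite /dstep /GRing.scale /=.
by field.
Qed.

Lemma continuous_dstep : continuous dstep.
Proof.
have c1 m : continuous (fun t : R => flat m (1 - t)).
  move=> t; apply: (@continuous_comp _ _ _ (fun t => 1 - t)).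
    by apply: cvgB => //; exact: cvg_cst.
  exact: continuous_flat.
move=> t; apply: cvgM.
  by apply: cvgD; apply: cvgM; try exact: continuous_flat; exact: c1.
apply: cvgV; first by rewrite expf_neq0// gt_eqF// step_den_gt0.
apply: (@continuous_comp _ _ _ (fun t => flat 0 t + flat 0 (1 - t)) (fun t => t ^+ 2)).
  by apply: cvgD; [exact: continuous_flat|exact: c1].
exact: exprn_continuous.
Qed.

(** [dstep] is continuous on [0, 1] and vanishes elsewhere. This bound is the constant factor that
    smoothing costs in the gradient. *)
Lemma dstep_bounded : exists2 C : R, 0 < C & forall t, dstep t <= C.
Proof.
have [|c _ cP] := @EVT_max R dstep 0 1 ler01.
  by apply: continuous_subspaceT; exact: continuous_dstep.
exists (dstep c + 1); first by rewrite ltr_wpDl ?dstep_ge0.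
move=> t; have [/andP[t0 t1]|tN] := boolP (0 < t < 1).
  by rewrite (le_trans (cP t _)) ?lerDl// in_itv/= !ltW.
by rewrite dstep_out// addr_ge0 ?dstep_ge0.
Qed.

Lemma se_step d (f : 'rV[R]_d -> R) : smooth_expr f ->
  smooth_expr (fun x => step (f x)).
Proof.
move=> sf; apply: se_mul; first exact: se_flat.
apply: se_inv => [|x]; last by rewrite gt_eqF// step_den_gt0.
apply: se_add; first exact: se_flat.
by apply: se_flat; apply: se_add; [exact: se_cst|exact: se_opp].
Qed.

End smooth_step.

(** * Lebesgue measure in radial coordinates *)

Section rV_measurable.
Context {R : realType} {d : nat}.
Local Notation Rd := 'rV[R]_d.

Lemma measurable_rv2tup : measurable_fun setT (@rv2tup R d).
Proof. by move=> _ B mB; exists B. Qed.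

Lemma measurable_coord (i : 'I_d) : measurable_fun setT (fun x : Rd => x ord0 i).
Proof.
have -> : (fun x : Rd => x ord0 i) = (@tnth _ R ^~ i) \o (@rv2tup R d).
  by apply/funext => x /=; rewrite tnth_mktuple.
by apply: measurableT_comp; [exact: measurable_tnth|exact: measurable_rv2tup].
Qed.

Lemma measurable_fun_rV d1 (T : measurableType d1) (f : T -> Rd) :
  (forall i, measurable_fun setT (fun t => f t ord0 i)) -> measurable_fun setT f.
Proof.
move=> mf _ _ [B mB <-]; rewrite !setTI.
have mg : measurable_fun setT (@rv2tup R d \o f).
  apply/measurable_fun_tnthP => i.
  rewrite (_ : _ \o _ = fun t => f t ord0 i)//.
  by apply/funext => t /=; rewrite tnth_mktuple.
by rewrite -comp_preimage -[X in measurable X]setTI; exact: mg.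
Qed.

Lemma measurable_eucl : measurable_fun setT (@eucl R d).
Proof.
rewrite (_ : eucl = Num.sqrt \o (fun x : Rd => \sum_(i < d) x ord0 i ^+ 2))//.
apply: measurableT_comp.
  by apply: continuous_measurable_fun; exact: sqrt_continuous.
apply: measurable_sum => i; apply: measurable_funX; exact: measurable_coord.
Qed.

Definition box (a b : 'I_d -> R) : set Rd :=
  [set x | forall i, a i <= x ord0 i <= b i].

(** Bounds with [a i > b i] are allowed, so the empty set is a box and the family is closed under
    intersection. *)
Definition boxes : set (set Rd) := [set X | exists a b, X = box a b].

Lemma boxes_setI : setI_closed boxes.
Proof.
move=> _ _ [a [b ->]] [a' [b' ->]].
exists (fun i => Num.max (a i) (a' i)), (fun i => Num.min (b i) (b' i)).
apply/seteqP; split => x /=.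
  move=> [h h'] i; have /andP[h1 h2] := h i; have /andP[h3 h4] := h' i.
  by rewrite ge_max le_min h1 h2 h3 h4.
move=> h; split => i; have := h i; rewrite ge_max le_min => /andP[/andP[? ?] /andP[? ?]].
  exact/andP.
exact/andP.
Qed.

Lemma measurable_box a b : measurable (box a b).
Proof.
rewrite (_ : box a b = \bigcap_(i in [set: 'I_d]) ((fun x : Rd => x ord0 i) @^-1` `[a i, b i])).
  apply: fin_bigcap_measurable => // i _.
  by rewrite -[X in measurable X]setTI; exact: measurable_coord.
apply/seteqP; split => x /=.
  by move=> h i _ /=; rewrite in_itv/=.
by move=> h i; have := h i I; rewrite /= in_itv/=.
Qed.

(** The sigma-algebra is generated by the coordinates, and that of the line by half-open intervals.
    It therefore suffices to write each slab a < x_i <= b as a countable union of closed boxes. *)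
Lemma measurable_rVE : (@measurable _ Rd) = <<s boxes >>.
Proof.
apply/seteqP; split; last first.
  apply: smallest_sub; first exact: sigma_algebra_measurable.
  by move=> _ [a [b ->]]; exact: measurable_box.
have -> : (@measurable _ Rd) = g_sigma_preimage (fun i (x : Rd) => x ord0 i).
  rewrite (_ : (fun i (x : Rd) => x ord0 i) =
    (fun i => (fun t : d.-tuple R => tnth t i) \o (@rv2tup R d))).
    by rewrite g_sigma_preimage_comp.
  by apply/funext => i; apply/funext => x /=; rewrite tnth_mktuple.
apply: smallest_sub; first exact: smallest_sigma_algebra.
elim/big_ind: _ => [//|A B hA hB X [/hA|/hB]//|i _ _ [B mB <-]].
have sG : sigma_algebra setT (image_set_system setT (fun x : Rd => x ord0 i) <<s boxes >>).
  by apply: sigma_algebra_image; exact: smallest_sigma_algebra.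
apply: (smallest_sub sG _ mB) => _ [[a b] _ <-]; rewrite /image_set_system /=.
(* The i-th side starts 1/(n+1) above a, which recovers the strict inequality in the union; the
   other sides [-n, n] exhaust the line. *)
pose F n := box (fun j => if j == i then a + n.+1%:R^-1 else - n%:R)
                (fun j => if j == i then b else n%:R).
rewrite (_ : _ `&` _ = \bigcup_n F n).
  apply: sigma_algebra_bigcup => n; apply: sub_sigma_algebra.
  by eexists; eexists.
rewrite setTI; apply/seteqP; split => x /=.
  rewrite in_itv/= => /andP[ax xb].
  pose N := Num.truncn (\sum_(j < d) `|x ord0 j|).
  have xN j : `|x ord0 j| <= N.+1%:R.
    rewrite (le_trans _ (ltW (truncnS_gt _)))// (bigD1 j)//= lerDl.
    by rewrite sumr_ge0.
  pose M := Num.truncn ((x ord0 i - a)^-1).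
  have aM : a + M.+1%:R^-1 <= x ord0 i.
    rewrite -lerBrDl invf_ple ?posrE ?subr_gt0//.
    exact: ltW (truncnS_gt _).
  exists (maxn M N.+1) => // j; case: eqP => [->|_].
    rewrite xb andbT (le_trans _ aM)// lerD2l lef_pV2 ?posrE// ler_nat ltnS.
    exact: leq_maxl.
  rewrite -ler_norml (le_trans (xN j))// ler_nat.
  exact: leq_maxr.
move=> [n _ h]; have := h i; rewrite eqxx in_itv/= => /andP[h1 ->].
by rewrite andbT (lt_le_trans _ h1)// ltrDl invr_gt0.
Qed.

End rV_measurable.

Section radial.
Context {R : realType} {d : nat}.
Local Notation Rd := 'rV[R]_d.
Context (lam : {measure set Rd -> \bar R}) (hlam : is_lebesgue_measure lam).

Lemma lam_box a b : (forall i, a i <= b i) ->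
  lam (box a b) = (\prod_(i < d) (b i - a i))%:E.
Proof. exact: hlam. Qed.

Lemma box_eq0 (a b : 'I_d -> R) i : b i < a i -> box a b = set0.
Proof.
move=> ba; apply/seteqP; split => // x /= /(_ i) /andP[h1 h2].
by have := le_lt_trans (le_trans h1 h2) ba; rewrite ltxx.
Qed.

Lemma measurable_scale (k : R) : measurable_fun setT (fun x : Rd => k *: x).
Proof.
apply: measurable_fun_rV => i.
rewrite (_ : (fun _ => _) = fun x : Rd => k * x ord0 i); last first.
  by apply/funext => x; rewrite mxE.
by apply: measurable_funM => //; exact: measurable_coord.
Qed.

Lemma preimage_scale_box (k : R) (a b : 'I_d -> R) : 0 < k ->
  (fun x : Rd => k *: x) @^-1` box a b = box (fun i => k^-1 * a i) (fun i => k^-1 * b i).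
Proof.
move=> k0; apply/seteqP; split => x /= h i; have := h i; rewrite mxE.
  by rewrite ler_pdivrMl// ler_pdivlMl.
by rewrite ler_pdivrMl// ler_pdivlMl.
Qed.

(** Both sides are measures in A which agree on boxes by the product formula. The boxes generate,
    are stable under intersection, and those of the form [-n, n]^d have finite measure and cover the
    space, so the measures coincide. *)
Lemma lam_scale (k : R) (A : set Rd) : 0 < k -> measurable A ->
  lam [set x | A (k *: x)] = ((k ^- d)%:E * lam A)%E.
Proof.
move=> k0 mA.
pose f : {mfun Rd >-> Rd} := HB.pack (fun x : Rd => k *: x)
  (isMeasurableFun.Build _ _ _ _ _ (measurable_scale k)).
have kd0 : 0 <= k ^- d by rewrite invr_ge0 exprn_ge0// ltW.
apply: (@measure_unique _ R Rd boxes (fun n => box (fun=> - n%:R) (fun=> n%:R))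
  _ _ _ _ (pushforward lam f) (mscale (NngNum kd0) lam)) mA.
- exact: measurable_rVE.
- exact: boxes_setI.
- by move=> n; eexists; eexists.
- apply/seteqP; split => // x _.
  exists (Num.truncn (\sum_(j < d) `|x ord0 j|)).+1 => //= i.
  rewrite -ler_norml (le_trans _ (ltW (truncnS_gt _)))// (bigD1 i)//= lerDl.
  by rewrite sumr_ge0.
- move=> _ [a [b ->]].
  change (lam ((fun x : Rd => k *: x) @^-1` box a b)%R = (k ^- d)%:E * lam (box a b))%E.
  rewrite preimage_scale_box//.
  have [ab|/existsNP[i /negP]] := pselect (forall i, a i <= b i); last first.
    rewrite -ltNge => ba; rewrite (box_eq0 _ _ i)//.
      by rewrite (box_eq0 _ _ i)// !measure0 mule0.
    by rewrite ltr_pM2l ?invr_gt0.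
  rewrite !lam_box//; last by move=> i; rewrite ler_pM2l ?invr_gt0.
  rewrite -EFinM; congr EFin.
  under eq_bigr do rewrite -mulrBr.
  by rewrite big_split/= prodr_const card_ord exprVn.
- move=> n.
  change (lam ((fun x : Rd => k *: x) @^-1` box (fun=> - n%:R) (fun=> n%:R))%R < +oo)%E.
  rewrite preimage_scale_box//.
  rewrite lam_box ?ltry// => i.
  by rewrite ler_pM2l ?invr_gt0// (@le_trans _ _ 0) ?oppr_le0.
Qed.

Lemma eucl_ge0 (x : Rd) : 0 <= eucl x. Proof. exact: sqrtr_ge0. Qed.

Lemma sqr_eucl (x : Rd) : eucl x ^+ 2 = \sum_(i < d) x ord0 i ^+ 2.
Proof. by rewrite sqr_sqrtr// sumr_ge0// => i _; exact: sqr_ge0. Qed.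

Lemma euclZ (k : R) (x : Rd) : 0 <= k -> eucl (k *: x) = k * eucl x.
Proof.
move=> k0; rewrite /eucl; under eq_bigr do rewrite mxE exprMn.
by rewrite -mulr_sumr sqrtrM ?sqr_ge0// sqrtr_sqr ger0_norm.
Qed.

Lemma coord_le_eucl (x : Rd) i : `|x ord0 i| <= eucl x.
Proof.
rewrite -(ler_pXn2r (n := 2)) ?nnegrE ?eucl_ge0// sqr_eucl (bigD1 i)//=.
by rewrite -normrX ger0_norm ?sqr_ge0// lerDl sumr_ge0// => j _; exact: sqr_ge0.
Qed.

Definition ball_vol : R := fine (lam [set x | eucl x <= 1]).

Lemma measurable_eucl_le (r : R) : measurable [set x : Rd | eucl x <= r].
Proof.
rewrite (_ : [set _ | _] = setT `&` @eucl R d @^-1` `]-oo, r]).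
  exact: measurable_eucl.
by rewrite setTI; apply/seteqP; split => x /=; rewrite in_itv.
Qed.

Lemma ball_volE : lam [set x | eucl x <= 1] = ball_vol%:E.
Proof.
rewrite fineK// ge0_fin_numE ?measure_ge0//.
apply: (@le_lt_trans _ _ (lam (box (fun=> -1) (fun=> 1)))).
  apply: le_measure; rewrite ?inE//; [exact: measurable_eucl_le|exact: measurable_box|].
  by move=> x /= h i; rewrite -ler_norml (le_trans (coord_le_eucl _ _)).
by rewrite lam_box ?ltry// => i; rewrite lerN10.
Qed.

Lemma ball_vol_ge0 : 0 <= ball_vol.
Proof. by rewrite fine_ge0. Qed.

(** For r > 0 this is scaling of the unit ball. For r = 0 the ball lies in a degenerate box, which
    is null because d > 0. *)
Lemma lam_eucl_le (r : R) : (0 < d)%N -> 0 <= r ->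
  lam [set x | eucl x <= r] = (ball_vol * r ^+ d)%:E.
Proof.
move=> d0; rewrite le_eqVlt => /predU1P[<-|r0].
  rewrite expr0n gtn_eqF// mulr0; apply/eqP; rewrite eq_le measure_ge0 andbT.
  apply: (@le_trans _ _ (lam (box (fun=> 0) (fun=> 0)))).
    apply: le_measure; rewrite ?inE//; [exact: measurable_eucl_le|exact: measurable_box|].
    move=> x /= h i; have /eqP -> : x ord0 i == 0 by rewrite -normr_le0 (le_trans (coord_le_eucl x i)).
    by rewrite lexx.
  rewrite lam_box// lee_fin; under eq_bigr do rewrite subr0.
  by rewrite prodr_const card_ord expr0n gtn_eqF.
rewrite (_ : [set _ | _] = [set x | [set y | eucl y <= 1] (r^-1 *: x)]); last first.
  apply/seteqP; split => x /=; rewrite euclZ ?invr_ge0 ?(ltW r0)//.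
    by rewrite ler_pdivrMl// mulr1.
  by rewrite ler_pdivrMl// mulr1.
rewrite lam_scale ?invr_gt0//; last exact: measurable_eucl_le.
by rewrite ball_volE exprVn invrK -EFinM mulrC.
Qed.

Definition radial (x : Rd) : R := eucl x ^+ d.

Lemma radial_ge0 x : 0 <= radial x. Proof. by rewrite exprn_ge0// eucl_ge0. Qed.

Lemma measurable_radial : measurable_fun setT radial.
Proof. by apply: measurable_funX; exact: measurable_eucl. Qed.

Lemma lam_radial_le (b : R) : (0 < d)%N -> 0 <= b ->
  lam [set x | radial x <= b] = (ball_vol * b)%:E.
Proof.
move=> d0 b0; pose r := b `^ (d%:R^-1).
have rb : r ^+ d = b.
  by rewrite /r -powR_mulrn ?powR_ge0// -powRrM mulVf ?powRr1// pnatr_eq0 -lt0n.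
rewrite (_ : [set _ | _] = [set x | eucl x <= r]).
  by rewrite lam_eucl_le ?powR_ge0// rb.
apply/seteqP; split => x /=; rewrite /radial -{1}rb ler_pXn2r ?nnegrE ?eucl_ge0 ?powR_ge0//.
Qed.

Lemma measurable_radialR : measurable_fun setT (radial : Rd -> measurableTypeR R).
Proof. exact: measurable_radial. Qed.

(** By uniqueness of measures it is enough to test half-open intervals ]a, b]. Their preimage is
    empty if b < 0, a ball if a < 0 <= b, and a difference of two balls if 0 <= a < b. *)
Lemma lam_radial (A : set R) : (0 < d)%N -> measurable A ->
  lam (radial @^-1` A) = (ball_vol%:E * lebesgue_measure (A `&` `[0%R, +oo[))%E.
Proof.
move=> d0 mA.
pose f : {mfun Rd >-> measurableTypeR R} := HB.pack radial
  (isMeasurableFun.Build _ _ _ _ _ measurable_radialR).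
have m0 : measurable (`[0, +oo[ : set (measurableTypeR R)) by exact: measurable_itv.
pose c := NngNum ball_vol_ge0.
have key (a b : R) : lam (radial @^-1` `]a, b]) =
    (ball_vol%:E * lebesgue_measure (`]a, b] `&` `[0%R, +oo[))%E.
  have [b0|b0] := ltP b 0.
    rewrite [X in lam X](_ : _ = set0) ?[X in lebesgue_measure X](_ : _ = set0) ?measure0 ?mule0//.
      apply/seteqP; split => // x /=; rewrite !in_itv/= andbT => -[/andP[_ xb]] x0.
      by have := le_lt_trans (le_trans x0 xb) b0; rewrite ltxx.
    apply/seteqP; split => // x /=; rewrite !in_itv/= => /andP[_ xb].
    by have := le_lt_trans (le_trans (radial_ge0 x) xb) b0; rewrite ltxx.
  have [a0|a0] := ltP a 0.
    rewrite [X in lam X](_ : _ = [set x | radial x <= b]) ?lam_radial_le//.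
      rewrite [X in lebesgue_measure X](_ : _ = `[0, b]%classic).
        by rewrite lebesgue_measure_itv/= lte_fin; case: ltgtP b0 => // [b0|<-] _;
          rewrite ?sube0 ?mule0 ?mulr0// -EFinM.
      apply/seteqP; split => x /=; rewrite !in_itv/= andbT.
        by move=> [/andP[_ ->] ->].
      by move=> /andP[x0 ->]; rewrite (lt_le_trans a0 x0) x0.
    apply/seteqP; split => x /=; rewrite !in_itv/=; first by move=> /andP[].
    by move=> ->; rewrite (lt_le_trans a0 (radial_ge0 x)).
  have [ba|ab] := leP b a.
    rewrite [X in lam X](_ : _ = set0) ?[X in lebesgue_measure X](_ : _ = set0) ?measure0 ?mule0//.
      by rewrite set_itv_ge ?set0I// bnd_simp -leNgt.
    by rewrite set_itv_ge ?preimage_set0// bnd_simp -leNgt.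
  rewrite [X in lam X](_ : _ = [set x | radial x <= b] `\` [set x | radial x <= a]); last first.
    apply/seteqP; split => x /=; rewrite in_itv/=.
      by move=> /andP[ax ->]; split => //; apply/negP; rewrite -ltNge.
    by move=> [-> /negP]; rewrite -ltNge => ->.
  have mr c' : measurable [set x : Rd | radial x <= c'].
    rewrite (_ : [set _ | _] = setT `&` radial @^-1` `]-oo, c']).
      exact: measurable_radial.
    by rewrite setTI; apply/seteqP; split => x /=; rewrite in_itv.
  have Fb : (lam [set x : Rd | radial x <= b]%R < +oo)%E by rewrite lam_radial_le// ltry.
  have -> : lam ([set x : Rd | radial x <= b]%R `\` [set x : Rd | radial x <= a]%R) =
      (lam [set x : Rd | radial x <= b]%R -
        lam ([set x : Rd | radial x <= b]%R `&` [set x : Rd | radial x <= a]%R))%E.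
    exact: measureD.
  rewrite setIidr ?lam_radial_le//; last by move=> x /= /le_trans; apply; exact: ltW.
  rewrite [X in lebesgue_measure X](_ : _ = `]a, b]%classic); last first.
    rewrite setIidl// => x /=; rewrite !in_itv/= andbT => /andP[ax _].
    by rewrite ltW// (le_lt_trans a0).
  by rewrite lebesgue_measure_itv/= lte_fin ab -EFinB -!EFinM mulrBr.
change (pushforward lam f A = mscale c (mrestr lebesgue_measure m0) A).
have mG : (@measurable _ (measurableTypeR R)) = <<s @ocitv R >> by [].
have H := @measure_unique _ R (measurableTypeR R) (@ocitv R)
  (fun n => `](- n%:R), n%:R]%classic) mG (@ocitvI R).
apply: (H _ _ (pushforward lam f) (mscale c (mrestr lebesgue_measure m0)) _ _ A mA).
- by move=> n; exists (- n%:R, n%:R).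
- apply/seteqP; split => // x _; exists (Num.truncn `|x|).+1 => //=.
  have := truncnS_gt `|x|; rewrite ltr_norml => /andP[h1 h2].
  by rewrite in_itv/= h1 ltW.
- by move=> _ [[a b] _ <-] /=; exact: key.
- move=> n; rewrite /= /pushforward key.
  rewrite (le_lt_trans _ (ltry (ball_vol * (n%:R - - n%:R))))// EFinM.
  apply: lee_wpmul2l; first by rewrite lee_fin ball_vol_ge0.
  apply: (@le_trans _ _ (lebesgue_measure (`](- n%:R), n%:R]%classic : set R))).
    by apply: le_measure; rewrite ?inE//; apply: measurableI.
  rewrite lebesgue_measure_itv/=; case: ifPn => // _.
Qed.

(** Change of variables through the pushforward of [lam] by [radial]. As D lies in the half-line,
    the restriction to it in [lam_radial] disappears. *)
Lemma ge0_integral_radial (D : set R) (f : R -> \bar R) : (0 < d)%N ->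
  measurable D -> D `<=` `[0, +oo[ -> measurable_fun D f ->
  (forall s, D s -> (0 <= f s)%E) ->
  (\int[lam]_(x in radial @^-1` D) f (radial x) =
   ball_vol%:E * \int[lebesgue_measure]_(s in D) f s)%E.
Proof.
move=> d0 mD D0 mf f0.
pose phi : {mfun Rd >-> measurableTypeR R} := HB.pack radial
  (isMeasurableFun.Build _ _ _ _ _ measurable_radialR).
pose c := NngNum ball_vol_ge0.
rewrite -(@ge0_integral_mscale _ (measurableTypeR R) R lebesgue_measure D mD c)//.
rewrite -(@eq_measure_integral _ (measurableTypeR R) R D _ (pushforward lam phi)).
  rewrite [RHS](@ge0_integral_pushforward _ _ _ (measurableTypeR R) R radial measurable_radialR lam D f)//.
  by move=> s; rewrite inE; exact: f0.
move=> A mA AD; rewrite /= /pushforward lam_radial//.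
by rewrite setIidl//; exact: subset_trans D0.
Qed.

End radial.

(** * Cell averages and smooth steps on the line *)

Section cell_average.
Context {R : realType}.
Context (s0 s1 : R) (s01 : s0 < s1).
Context (b : R -> R) (M : R).
Hypotheses (mb : measurable_fun setT b) (bM : forall s, 0 <= b s <= M).
Implicit Types (k j : nat) (s : R).
Local Notation mu := (@lebesgue_measure R).

Definition mesh k : R := (s1 - s0) / k.+1%:R.
Definition node k j : R := s0 + j%:R * mesh k.
Definition cell k j : set R := `]node k j, node k j.+1]%classic.
Definition mass k j : R := \int[mu]_(s in cell k j) b s.
(** The conditional expectation of b on the k-th grid of ]s0, s1], extended by 0. *)
Definition cell_avg k s : R := \sum_(j < k.+1) mass k j / mesh k * \1_(cell k j) s.

Lemma mesh_gt0 k : 0 < mesh k.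
Proof. by rewrite divr_gt0 ?subr_gt0. Qed.

Lemma node0 k : node k 0 = s0. Proof. by rewrite /node mul0r addr0. Qed.

Lemma node_last k : node k k.+1 = s1.
Proof. by rewrite /node /mesh mulrC divfK ?pnatr_eq0// addrC subrK. Qed.

Lemma nodeS k j : node k j.+1 = node k j + mesh k.
Proof. by rewrite /node -natr1 mulrDl mul1r addrA. Qed.

Lemma node_lt k j : node k j < node k j.+1.
Proof. by rewrite nodeS ltrDl mesh_gt0. Qed.

Lemma le_node k i j : (i <= j)%N -> node k i <= node k j.
Proof. by move=> ij; rewrite lerD2l ler_wpM2r ?ler_nat// ltW// mesh_gt0. Qed.

Lemma node_ge k j : s0 <= node k j.
Proof. by rewrite -{1}(node0 k) le_node. Qed.

Lemma measurable_cell k j : measurable (cell k j).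
Proof. exact: measurable_itv. Qed.

Lemma lebesgue_itv_cc_lty (x y : R) :
  (lebesgue_measure (`[x, y]%classic : set R) < +oo)%E.
Proof. by rewrite lebesgue_measure_itv/=; case: ifP => _; rewrite -?EFinB ltry. Qed.

Lemma lebesgue_cell k j : lebesgue_measure (cell k j : set R) = (mesh k)%:E.
Proof.
rewrite /cell lebesgue_measure_itv/= lte_fin node_lt -EFinB nodeS.
by rewrite addrC addKr.
Qed.

Lemma lebesgue_cell_lty k j : (lebesgue_measure (cell k j : set R) < +oo)%E.
Proof. by rewrite lebesgue_cell ltry. Qed.

Lemma integrable_itv_b (i : interval R) (x y : R) :
  [set` i] `<=` `[x, y] -> mu.-integrable [set` i] (EFin \o b).
Proof.
move=> ixy; apply: (@integrableS _ _ _ mu `[x, y]%classic) => //.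
apply: measurable_bounded_integrable => //.
- exact: lebesgue_itv_cc_lty.
- exact: measurable_funS mb.
- exists M; split; rewrite ?num_real// => N MN z _ /=.
  by have /andP[b0 bz] := bM z; rewrite ger0_norm// (le_trans bz)// ltW.
Qed.

Lemma mass_ge0 k j : 0 <= mass k j.
Proof. by apply: Rintegral_ge0 => x _; have /andP[] := bM x. Qed.

(** Written as a difference of values of the primitive, the masses have a telescoping sum. *)
Lemma massE k j : mass k j = \int[mu]_(s in `[s0, node k j.+1]) b s
                           - \int[mu]_(s in `[s0, node k j]) b s.
Proof.
rewrite Rintegral_itvB//.
- by apply: integrable_itv_b; exact: subset_refl.
- by rewrite bnd_simp node_ge.
- by rewrite bnd_simp ltW// node_lt.
Qed.

Lemma sum_mass k : \sum_(j < k.+1) mass k j = \int[mu]_(s in `]s0, s1]) b s.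
Proof.
rewrite (eq_bigr (fun j : 'I_k.+1 => \int[mu]_(s in `[s0, node k j.+1]) b s
                           - \int[mu]_(s in `[s0, node k j]) b s)); last first.
  by move=> j _; exact: massE.
rewrite -(big_mkord xpredT (fun j => \int[mu]_(s in `[s0, node k j.+1]) b s
                           - \int[mu]_(s in `[s0, node k j]) b s)).
rewrite telescope_sumr// node0 node_last Rintegral_itvB//.
- by apply: integrable_itv_b; exact: subset_refl.
- by rewrite bnd_simp.
- by rewrite bnd_simp ltW.
Qed.

Lemma mass_le k j : mass k j <= M * mesh k.
Proof.
have -> : M * mesh k = \int[mu]_(s in cell k j) cst M s.
  rewrite Rintegral_cst//=; last exact: measurable_itv.
  by rewrite lebesgue_cell.
apply: le_Rintegral; first exact: measurable_itv.
- by apply: integrable_itv_b (node k j) (node k j.+1) _; exact: subset_itv_oc_cc.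
- apply: measurable_bounded_integrable => //; first exact: measurable_itv.
    exact: lebesgue_cell_lty.
  exists M; split; rewrite ?num_real// => N MN z _ /=.
  rewrite ger0_norm ?(ltW MN)//.
  by have /andP[b0 bz] := bM z; exact: le_trans bz.
- by move=> x _; have /andP[] := bM x.
Qed.

Lemma cell_avg_ge0 k s : 0 <= cell_avg k s.
Proof.
apply: sumr_ge0 => j _; apply: mulr_ge0; last by rewrite indicE.
by apply: divr_ge0; [exact: mass_ge0|exact: ltW (mesh_gt0 k)].
Qed.

Lemma measurable_cell_avg k : measurable_fun setT (cell_avg k).
Proof.
apply: measurable_sum => j; apply: measurable_funM => //.
exact: measurable_indic (measurable_cell k j).
Qed.

(* The grid is extended to the whole line because [nice_lebesgue_differentiation]
   asks for nicely shrinking sets around every real number. *)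
Let idx k (x : R) : int := Num.ceil ((x - s0) / mesh k).
Let gcell (x : R) k : set R :=
  `](s0 + (idx k x - 1)%:~R * mesh k), (s0 + (idx k x)%:~R * mesh k)]%classic.

Let mem_gcell x k : gcell x k x.
Proof.
rewrite /gcell /= in_itv/= -ltrBrDl -lerBlDl -ltr_pdivlMr ?mesh_gt0//.
by rewrite -ler_pdivrMr ?mesh_gt0// ceil_itv.
Qed.

(** Cells are open on the left, which matches rounding up. The index being determined by the point,
    this also shows that distinct cells are disjoint. *)
Let gcell_idx k j x : cell k j x -> idx k x = j.+1.
Proof.
rewrite /cell /= in_itv/= => /andP[h1 h2].
apply: ceil_def.
rewrite ltr_pdivlMr ?mesh_gt0// ler_pdivrMr ?mesh_gt0//.
rewrite ltrBrDl lerBlDl; apply/andP; split; last exact: h2.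
by rewrite -addn1 PoszD addrK.
Qed.

Let gcell_cell k j x : cell k j x -> gcell x k = cell k j.
Proof. by move=> /gcell_idx ix; rewrite /gcell ix /cell /node -addn1 PoszD addrK. Qed.

Let cover_cell k x : s0 < x <= s1 -> exists2 j : 'I_k.+1, cell k j x & gcell x k = cell k j.
Proof.
move=> /andP[x0 x1].
have i0 : 0 < idx k x by rewrite ceil_gt0 divr_gt0 ?subr_gt0// mesh_gt0.
have i1 : idx k x <= k.+1.
  rewrite ceil_le_int /= ler_pdivrMr ?mesh_gt0// lerBlDl.
  by rewrite (le_trans x1)// -(node_last k).
case E : (idx k x) i0 i1 => [[|m]|//] // _ mk.
have mk' : (m < k.+1)%N by [].
have xm : cell k m x.
  have := mem_gcell x k; rewrite /gcell E /cell /node.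
  by rewrite -addn1 PoszD addrK.
by exists (Ordinal mk') => //; exact: gcell_cell.
Qed.

Let nice_gcell x : nicely_shrinking x (gcell x).
Proof.
have d0 k : 0 < mesh k by exact: mesh_gt0.
split; first by move=> n; exact: measurable_itv.
(* A cell containing x lies in the ball of radius [mesh k] around x, whose length is twice that of
   the cell. *)
exists (2, fun k => PosNum (d0 k)); split => //=.
- rewrite /mesh -(mulr0 (s1 - s0)).
  by apply: cvgM; [exact: cvg_cst|exact: cvg_harmonic].
- move=> k y; have := mem_gcell x k; rewrite /gcell /= !in_itv/=.
  rewrite rmorphB/= mulrBl mul1r -ball_normE/= ltr_distl => /andP[h1 h2] /andP[h3 h4].
  by apply/andP; split; lra.
- move=> k; have dk := ltW (d0 k); rewrite lebesgue_measure_ball//.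
  rewrite /gcell lebesgue_measure_itv/= lte_fin ltrD2l ltr_pM2r// ltr_int.
  rewrite gtrBl ltr01 -EFinB -EFinM lee_fin.
  rewrite rmorphB/=; lra.
Qed.

(** At a Lebesgue point of b the averages over nicely shrinking sets converge to the value of b. On
    ]s0, s1] these sets are the cells of the grid, and only the cell containing s contributes to
    [cell_avg k s]. *)
Lemma cvg_cell_avg : {ae mu, forall s, s0 < s <= s1 -> cell_avg k s @[k --> \oo] --> b s}.
Proof.
have lb : locally_integrable setT b.
  split => //; first exact: openT.
  move=> K _ cK.
  have /integrableP[] : mu.-integrable K (EFin \o b).
    apply: measurable_bounded_integrable.
    - exact: compact_measurable.
    - exact: compact_finite_measure.
    - exact: measurable_funS mb.
    - exists M; split; rewrite ?num_real// => N MN z _ /=.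
      by have /andP[b0 bz] := bM z; rewrite ger0_norm// (le_trans bz)// ltW.
  by [].
have := lebesgue_differentiation lb.
apply: (@filterS _ _ (ae_filter_ringOfSetsType mu)) => s bs sD.
have := nice_lebesgue_differentiation nice_gcell lb bs.
move=> /fine_cvgP[_].
apply: cvg_trans; apply: near_eq_cvg; apply: nearW => k /=.
have [j sj gE] := cover_cell k s sD.
rewrite /cell_avg (bigD1 j)//= big1 ?addr0; last first.
  move=> i ij; rewrite indicE memNset ?mulr0// => si.
  move: ij => /eqP; apply; apply/val_inj => /=.
  have := gcell_idx k i s si; rewrite (gcell_idx k j s sj) => -[].
  by [].
rewrite gE indicE mem_set// mulr1 mulrC.
rewrite (lebesgue_cell k j) inver gt_eqF ?mesh_gt0// fineM//.
apply: integrable_fin_num; first exact: measurable_cell.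
by apply: integrable_itv_b; exact: subset_itv_oc_cc.
Qed.

Lemma cell_avg_le k s : cell_avg k s <= M.
Proof.
have M0 : 0 <= M by have /andP[h1 h2] := bM 0; exact: le_trans h2.
have [[i si]|h] := pselect (exists i : 'I_k.+1, cell k i s); last first.
  rewrite /cell_avg big1// => i _; rewrite indicE memNset ?mulr0// => si.
  by apply: h; exists i.
rewrite /cell_avg (bigD1 i)//= big1 ?addr0; last first.
  move=> j ij; rewrite indicE memNset ?mulr0// => sj.
  move: ij => /eqP; apply; apply/val_inj => /=.
  have := gcell_idx k i s si; rewrite (gcell_idx k j s sj) => -[].
  by [].
rewrite indicE mem_set// mulr1 ler_pdivrMr ?mesh_gt0//.
exact: mass_le.
Qed.

Lemma cell_avg_out k s : ~~ (s0 < s <= s1) -> cell_avg k s = 0.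
Proof.
move=> sD; rewrite /cell_avg big1// => j _; rewrite indicE memNset ?mulr0//.
rewrite /cell /= in_itv/= => /andP[h1 h2]; move/negP : sD; apply.
rewrite (le_lt_trans (node_ge k j) h1) (le_trans h2)// -(node_last k).
exact: le_node.
Qed.

(* Gluing the steps at the squared nodes makes [Gamma (radial x ^+ 2)] a polynomial
   expression in [x] composed with [step], hence smooth also for odd dimension. *)
Definition Gamma k (t : R) : R := \sum_(j < k.+1) mass k j *
  step ((t - node k j ^+ 2) / (node k j.+1 ^+ 2 - node k j ^+ 2)).

Definition dGamma k (t : R) : R := \sum_(j < k.+1) mass k j *
  (dstep ((t - node k j ^+ 2) / (node k j.+1 ^+ 2 - node k j ^+ 2))
   / (node k j.+1 ^+ 2 - node k j ^+ 2)).

Hypothesis s00 : 0 < s0.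

Lemma sqr_node_lt k j : 0 < node k j.+1 ^+ 2 - node k j ^+ 2.
Proof.
have n0 i : 0 < node k i by rewrite (lt_le_trans s00)// node_ge.
by rewrite subr_gt0 ltr_pXn2r ?nnegrE ?node_lt// ltW.
Qed.

Lemma is_derive_Gamma k (t : R) : is_derive t 1 (Gamma k) (dGamma k t).
Proof.
pose h j : R -> R := fun t => mass k j *
  step ((t - node k j ^+ 2) / (node k j.+1 ^+ 2 - node k j ^+ 2)).
have -> : Gamma k = \sum_(j < k.+1) h j.
  by apply/funext => s; rewrite fct_sumE.
apply: is_derive_sum => j.
set w := node k j.+1 ^+ 2 - node k j ^+ 2.
have H1 : is_derive t 1 (fun s : R => w^-1 * (s - node k j ^+ 2)) (w^-1 * 1).
  have := is_deriveZ w^-1 (is_deriveB (is_derive_id t (1 : R)) (is_derive_cst (node k j ^+ 2) t (1 : R))).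
  by rewrite subr0.
have H2 := is_derive1_comp (is_derive_step _) H1.
have H3 := is_deriveZ (mass k j) H2.
rewrite mulr1 in H3; rewrite /h.
have -> : (fun s : R => mass k j * step ((s - node k j ^+ 2) / w)) =
  mass k j \*: (step \o (fun s : R => w^-1 * (s - node k j ^+ 2))).
  by apply/funext => s /=; rewrite mulrC [w^-1 * _]mulrC mulrC.
by rewrite [(t - _) / w]mulrC; exact: H3.
Qed.

Lemma Gamma_ge0 k t : 0 <= Gamma k t.
Proof. by apply: sumr_ge0 => j _; rewrite mulr_ge0 ?mass_ge0 ?step_ge0. Qed.

Lemma dGamma_ge0 k t : 0 <= dGamma k t.
Proof.
apply: sumr_ge0 => j _; apply: mulr_ge0; first exact: mass_ge0.
by apply: divr_ge0; [exact: dstep_ge0|exact: ltW (sqr_node_lt _ _)].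
Qed.

Lemma Gamma_le k t : Gamma k t <= \int[mu]_(s in `]s0, s1]) b s.
Proof.
rewrite -(sum_mass k); apply: ler_sum => j _.
by rewrite ler_piMr ?mass_ge0 ?step_le1.
Qed.

Lemma Gamma_eq0 k t : t <= s0 ^+ 2 -> Gamma k t = 0.
Proof.
move=> ts; rewrite /Gamma big1// => j _; rewrite step_eq0 ?mulr0//.
rewrite pmulr_lle0 ?invr_gt0 ?sqr_node_lt// subr_le0 (le_trans ts)//.
by rewrite ler_pXn2r ?nnegrE ?node_ge ?(ltW s00)// (le_trans (ltW s00))// node_ge.
Qed.

Lemma Gamma_eq k t : s1 ^+ 2 <= t -> Gamma k t = \int[mu]_(s in `]s0, s1]) b s.
Proof.
move=> ts; rewrite -(sum_mass k); apply: eq_bigr => j _.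
rewrite step_eq1 ?mulr1// ler_pdivlMr ?sqr_node_lt// mul1r lerD2r.
rewrite (le_trans _ ts)// -(node_last k).
have n0 i : 0 <= node k i by rewrite (le_trans (ltW s00))// node_ge.
by rewrite ler_pXn2r ?nnegrE ?n0// le_node// ltn_ord.
Qed.

(** The left side is half the derivative of s |-> [Gamma k (s ^+ 2)]. Only a cell containing s can
    contribute. If that cell is ]x, x + h], then s <= x + h <= 2x + h, so s divided by (x + h)^2 -
    x^2 = h (2x + h) is at most 1/h, the factor that turns mass into average. *)
Lemma dGamma_le C k s : (forall t : R, dstep t <= C) -> 0 <= s ->
  dGamma k (s ^+ 2) * s <= C * cell_avg k s.
Proof.
move=> dC s_ge0; rewrite /dGamma /cell_avg mulr_suml mulr_sumr.
have n0 i : 0 < node k i by rewrite (lt_le_trans s00)// node_ge.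
have m0 := mesh_gt0 k.
apply: ler_sum => j _; have w0 := sqr_node_lt k j.
set w := _ - _ in w0 *.
rewrite -[leLHS]mulrA [leRHS]mulrCA -[leRHS]mulrA; apply: ler_wpM2l; first exact: mass_ge0.
rewrite [leRHS]mulrCA -[leLHS]mulrA.
have [sj|sj] := pselect (cell k j s); last first.
  rewrite indicE memNset// !mulr0 dstep_out ?mul0r//.
  apply/negP => /andP[h1 h2]; apply: sj; rewrite /cell /= in_itv/=.
  move: h1; rewrite pmulr_lgt0 ?invr_gt0// subr_gt0 ltr_pXn2r ?nnegrE ?(ltW (n0 _))// => ->/=.
  move: h2; rewrite ltr_pdivrMr// mul1r ltrD2r ltr_pXn2r ?nnegrE ?(ltW (n0 _))//.
  exact: ltW.
rewrite indicE mem_set// mulr1.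
move: sj; rewrite /cell /= in_itv/= => /andP[s1' s2'].
apply: ler_pM => //.
- exact: dstep_ge0.
- by rewrite mulr_ge0// invr_ge0 ltW.
- rewrite mulrC ler_pdivrMr// ler_pdivlMl// /w nodeS.
  rewrite nodeS in s2'.
  have := n0 j; move: s2' m0; set x := node k j; set h := mesh k => *.
  nra.
Qed.

End cell_average.

(** * Energy of radial cutoffs *)

Section energy.
Context {R : realType} {d : nat}.
Local Notation Rd := 'rV[R]_d.

(** The Cauchy-Schwarz inequality for the Frobenius product of A with the matrix (v_i v_j), whose
    norm is the sum of the squares v_i^2. *)
Lemma quadratic_form_le (A : 'I_d -> 'I_d -> R) (v : 'I_d -> R) :
  \sum_(i < d) \sum_(j < d) A i j * v i * v j <=
  Num.sqrt (\sum_(i < d) \sum_(j < d) A i j ^+ 2) * \sum_(i < d) v i ^+ 2.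
Proof.
set S := \sum_(i < d) _; set N := \sum_(i < d) \sum_(j < d) _; set V := \sum_(i < d) v i ^+ 2.
have V0 : 0 <= V by apply: sumr_ge0 => i _; exact: sqr_ge0.
have N0 : 0 <= N by do 2 (apply: sumr_ge0 => ? _); exact: sqr_ge0.
have E t : N - t * S *+ 2 + t ^+ 2 * V ^+ 2 =
    \sum_(i < d) \sum_(j < d) (A i j - t * (v i * v j)) ^+ 2.
  have -> : \sum_(i < d) \sum_(j < d) (A i j - t * (v i * v j)) ^+ 2 =
      \sum_(i < d) \sum_(j < d) (A i j ^+ 2 + (- (t *+ 2) * (A i j * v i * v j) +
        t ^+ 2 * (v i ^+ 2 * v j ^+ 2))).
    by apply: eq_bigr => i _; apply: eq_bigr => j _; ring.
  under eq_bigr do rewrite !big_split/= -!mulr_sumr.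
  by rewrite !big_split/= -!mulr_sumr -mulr_suml -/S -/N -/V; ring.
have pos t : 0 <= N - t * S *+ 2 + t ^+ 2 * V ^+ 2.
  by rewrite E; do 2 (apply: sumr_ge0 => ? _); exact: sqr_ge0.
have SNV : S ^+ 2 <= N * V ^+ 2.
  have [V_eq0|VN0] := eqVneq V 0.
    have v_eq0 i : v i = 0.
      move: V_eq0 => /eqP; rewrite psumr_eq0 => [/allP/(_ i)|j _]; last exact: sqr_ge0.
      by rewrite mem_index_enum => /(_ isT)/=; rewrite sqrf_eq0 => /eqP.
    rewrite /S big1 ?expr0n ?mulr_ge0 ?sqr_ge0// => i _.
    by rewrite big1// => j _; rewrite v_eq0 mulr0 mul0r.
  (* This t minimizes the quadratic polynomial in [pos]; the other case, V = 0, forces v = 0. *)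
  have := pos (S / V ^+ 2).
  have V2 : 0 < V ^+ 2 by rewrite exprn_even_gt0.
  rewrite -(pmulr_rge0 _ V2) => h.
  rewrite -subr_ge0; apply: le_trans h _.
  by rewrite le_eqVlt; apply/orP; left; apply/eqP; field.
have [S0|S0] := leP S 0; first by rewrite (le_trans S0)// mulr_ge0// sqrtr_ge0.
rewrite -(ler_pXn2r (n := 2)) ?nnegrE ?mulr_ge0 ?sqrtr_ge0 ?(ltW S0)//.
by rewrite exprMn sqr_sqrtr.
Qed.

Context (lam : {measure set Rd -> \bar R}) (varphi : Rd -> R).
Context (a : 'I_d -> 'I_d -> Rd -> R) (phi : R -> R) (K : set Rd).
Hypothesis hvarphi_pos : {ae lam, forall x, 0 < varphi x}.
Hypothesis hwell_defined : forall f g : Rd -> R, C0inf f -> C0inf g ->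
     forall i j, lam.-integrable setT
       (fun x => (a i j x * partial i f x * partial j g x * varphi x)%:E).
Hypothesis hbound : forall x, ~ K x -> normA a x * varphi x <= phi (eucl x).

(** The integrand of the form is not known to be nonnegative at each point, so it is first replaced
    by its positive part. That part vanishes off A, and on A it is almost everywhere at most G, by
    the matrix bound multiplied by [varphi] > 0. *)
Lemma dform_le (u : Rd -> R) (A : set Rd) (G : Rd -> R) :
  C0inf u -> measurable A -> A `<=` ~` K -> measurable_fun A G ->
  (forall x, A x -> 0 <= G x) ->
  (forall x, ~ A x -> forall i, partial i u x = 0) ->
  (forall x, A x -> (\sum_(i < d) partial i u x ^+ 2) * Num.max 0 (phi (eucl x)) <= G x) ->
  ((dform lam varphi a u u)%:E <= \int[lam]_(x in A) (G x)%:E)%E.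
Proof.
move=> Cu mA AK mG G0 u0 uG.
pose t i j x := a i j x * partial i u x * partial j u x * varphi x.
have it i j : lam.-integrable setT (EFin \o t i j) by exact: hwell_defined.
pose f x := \sum_(i < d) \sum_(j < d) t i j x.
have if1 i : lam.-integrable setT (fun x => \sum_(j < d) (t i j x)%:E)%E.
  by apply: integrable_sum => [|j _]; [exact: measurableT|exact: it].
have if_ : lam.-integrable setT (fun x => \sum_(i < d) \sum_(j < d) (t i j x)%:E)%E.
  by apply: integrable_sum => [|i _]; [exact: measurableT|exact: if1].
have fE : (fun x => \sum_(i < d) \sum_(j < d) (t i j x)%:E)%E = EFin \o f.
  by apply/funext => x /=; rewrite /f -sumEFin; apply: eq_bigr => i _; rewrite -sumEFin.
have dE : (dform lam varphi a u u)%:E = (\int[lam]_x (f x)%:E)%E.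
  rewrite /dform -sumEFin.
  transitivity (\int[lam]_x (\sum_(i < d) \sum_(j < d) (t i j x)%:E))%E; last by rewrite fE.
  rewrite (integral_sum measurableT if1); apply: eq_bigr => i _.
  rewrite (integral_sum measurableT (it i)) -sumEFin; apply: eq_bigr => j _.
  by rewrite /Rintegral fineK//; apply: (integrable_fin_num measurableT (it i j)).
rewrite dE integralE.
have mf : measurable_fun setT (EFin \o f) by rewrite -fE; exact: measurable_int if_.
apply: (@le_trans _ _ (\int[lam]_x (EFin \o f)^\+ x)%E).
  by apply: geeDl; rewrite oppe_le0 integral_ge0.
rewrite [leRHS]integral_mkcond.
apply: ae_ge0_le_integral => //.
- exact: measurable_funepos.
- by move=> x _; rewrite erestrict_ge0.
- by apply/(measurable_restrictT _ _).1 => //; exact/measurable_EFinP.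
move: hvarphi_pos; apply: filterS => x vx _.
have [Ax|Ax] := pselect (A x); last first.
  rewrite patchN ?notin_setE// funeposE /= /f.
  rewrite big1 ?maxxx// => i _; rewrite big1// => j _.
  by rewrite /t u0// mulr0 !mul0r.
rewrite patchT ?inE// funeposE /= -EFin_max lee_fin ge_max G0// andbT.
apply: le_trans (uG x Ax).
have -> : f x = (\sum_(i < d) \sum_(j < d) a i j x * partial i u x * partial j u x) * varphi x.
  by rewrite /f mulr_suml; apply: eq_bigr => i _; rewrite mulr_suml.
apply: le_trans (ler_wpM2r (ltW vx) (quadratic_form_le (fun i j => a i j x) (fun i => partial i u x))) _.
rewrite mulrAC mulrC ler_wpM2l ?sumr_ge0// => [i _|]; first exact: sqr_ge0.
by rewrite le_max; apply/orP; right; exact/hbound/AK.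
Qed.

End energy.

Section radial_cutoff.
Context {R : realType} {d : nat} (d0 : (0 < d)%N).
Local Notation Rd := 'rV[R]_d.

Lemma continuous_eucl : continuous (@eucl R d).
Proof.
move=> x; apply: (@continuous_comp _ _ _ (fun x : Rd => \sum_(i < d) x ord0 i ^+ 2)).
  apply: continuous_smooth_expr; apply: se_sum => i; apply: se_exp; exact: se_coord.
exact: sqrt_continuous.
Qed.

Lemma closed_eucl_itv (r s : R) : closed [set x : Rd | r <= eucl x <= s].
Proof.
rewrite (_ : [set _ | _] = @eucl R d @^-1` `[r, s]).
  by apply: (continuous_closedP _).1; [exact: continuous_eucl|exact: itv_closed].
by apply/seteqP; split => x /=; rewrite in_itv.
Qed.

Lemma compact_eucl_itv (r s : R) : compact [set x : Rd | r <= eucl x <= s].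
Proof.
have cB : compact [set v : Rd | forall i, v ord0 i \in `[(- s), s]].
  by apply: (@rV_compact _ _ (fun=> `[(- s), s]%classic)) => _; exact: segment_compact.
apply: subclosed_compact cB _; first exact: closed_eucl_itv.
move=> x /= /andP[_ xs] i; rewrite in_itv/= -ler_norml.
exact: le_trans (coord_le_eucl x i) xs.
Qed.

Lemma sqr_radial (x : Rd) : radial x ^+ 2 = (\sum_(i < d) x ord0 i ^+ 2) ^+ d.
Proof. by rewrite /radial -sqr_eucl -!exprM mulnC. Qed.

Lemma se_sqr_radial : smooth_expr (fun x : Rd => radial x ^+ 2).
Proof.
under eq_fun do rewrite sqr_radial.
by apply: se_exp; apply: se_sum => i; apply: se_exp; exact: se_coord.
Qed.

Lemma is_derive_sqr_radial (x : Rd) i :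
  is_derive x (e_ i) (fun x => radial x ^+ 2)
    (d%:R * (eucl x ^+ 2) ^+ d.-1 * (2 * x ord0 i)).
Proof.
have H1 (j : 'I_d) := is_deriveX 2 (is_derive_coord i j x).
have H2 := is_deriveX d (is_derive_sum H1).
have -> : (fun x : Rd => radial x ^+ 2) = (\sum_(j < d) (fun x : Rd => x ord0 j) ^+ 2) ^+ d.
  by apply/funext => y; rewrite exprfctE fct_sumE sqr_radial.
apply: is_derive_eq H2 _.
rewrite /GRing.scale /= fct_sumE sqr_eucl; congr (_ * _).
rewrite (bigD1 i)//= big1 ?addr0; last by move=> j ji; rewrite (negbTE ji) mulr0.
by rewrite eqxx mulr1 expr1.
Qed.

Context (lam : {measure set Rd -> \bar R}) (hlam : is_lebesgue_measure lam).
Context (r0 r1 : R) (r00 : 0 < r0) (r01 : r0 < r1).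
Context (b : R -> R) (M : R).
Hypotheses (mb : measurable_fun setT b) (bM : forall s, 0 <= b s <= M).
Local Notation s0 := (r0 ^+ d).
Local Notation s1 := (r1 ^+ d).
Local Notation mu := (@lebesgue_measure R).
Definition total_mass : R := \int[mu]_(s in `]s0, s1]) b s.
Local Notation F := total_mass.
Hypothesis F0 : 0 < F.

Definition cutoff k (x : Rd) : R := 1 - Gamma s0 s1 b k (radial x ^+ 2) / F.

Let s00 : 0 < s0. Proof. by rewrite exprn_gt0. Qed.
Let s01 : s0 < s1.
Proof. by rewrite ltr_pXn2r ?nnegrE ?ltW// (lt_trans r00). Qed.

Lemma cutoff_itv k x : 0 <= cutoff k x <= 1.
Proof.
rewrite subr_ge0 gerBl ler_pdivrMr// mul1r divr_ge0 ?(ltW F0) ?Gamma_ge0//= ?andbT//.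
  exact: (Gamma_le _ _ s01 _ _ mb bM).
exact: (Gamma_ge0 _ _ _ _ bM).
Qed.

Lemma cutoff_in k x : eucl x <= r0 -> cutoff k x = 1.
Proof.
move=> xr; rewrite /cutoff (Gamma_eq0 _ _ s01 _ s00) ?mul0r ?subr0//.
rewrite ler_pXn2r ?nnegrE ?radial_ge0 ?(ltW s00)//.
by rewrite ler_pXn2r ?nnegrE ?eucl_ge0 ?(ltW r00)// ?lt0n_neq0.
Qed.

Lemma cutoff_out k x : r1 <= eucl x -> cutoff k x = 0.
Proof.
move=> xr; rewrite /cutoff (Gamma_eq _ _ s01 _ _ mb bM s00) ?divff ?subrr ?gt_eqF//.
have r10 : 0 < r1 by exact: lt_trans r01.
rewrite ler_pXn2r ?nnegrE ?radial_ge0 ?exprn_ge0 ?(ltW r10)//.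
by rewrite ler_pXn2r ?nnegrE ?eucl_ge0 ?(ltW r10).
Qed.

Lemma C0inf_cutoff k : C0inf (cutoff k).
Proof.
split.
  apply: smooth_smooth_expr; apply: se_add; first exact: se_cst.
  apply: se_opp; apply: se_mul; last exact: se_cst.
  apply: se_sum => j; apply: se_mul; first exact: se_cst.
  apply: se_step; apply: se_mul; last exact: se_cst.
  by apply: se_add; [exact: se_sqr_radial|exact: se_cst].
apply: subclosed_compact (compact_eucl_itv 0 r1) _; first exact: closed_closure.
rewrite [X in _ `<=` X](closure_id _).1; last exact: closed_eucl_itv.
apply: closure_subset => x /= /eqP ux; rewrite eucl_ge0/= leNgt.
by apply/negP => /ltW /(cutoff_out k).
Qed.

Lemma measurable_cutoff k : measurable_fun setT (cutoff k).
Proof.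
apply: measurable_funB; first exact: measurable_cst.
apply: measurable_funM; last exact: measurable_cst.
apply: (@measurableT_comp _ _ _ _ _ _ (Gamma s0 s1 b k)).
  apply: continuous_measurable_fun => t.
  have [dG _] := is_derive_Gamma s0 s1 b k t.
  by apply: differentiable_continuous; apply/derivable1_diffP.
by apply: measurable_funX; exact: measurable_radial.
Qed.

Lemma partial_cutoff k x i : partial i (cutoff k) x =
  - F^-1 * (dGamma s0 s1 b k (radial x ^+ 2) *
    (d%:R * (eucl x ^+ 2) ^+ d.-1 * (2 * x ord0 i))).
Proof.
have H1 := is_derive_comp _ _ _ _ _ _ (is_derive_sqr_radial x i)
  (is_derive_Gamma s0 s1 b k (radial x ^+ 2)).
have H2 := is_deriveB (is_derive_cst (1 : R) x (e_ i)) (is_deriveZ F^-1 H1).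
have [_ H3] := H2.
rewrite /partial (_ : cutoff k = cst 1 - F^-1 \*: (Gamma s0 s1 b k \o (fun x => radial x ^+ 2))).
  by rewrite H3 sub0r mulNr.
by apply/funext => y; rewrite /cutoff mulrC.
Qed.

(** The gradient of |x|^(2d) has norm 2d |x|^d |x|^(d-1). The factor |x|^d = [radial x] is kept next
    to [dGamma], since their product is what the cell average controls. *)
Lemma sum_sqr_partial_cutoff k x :
  \sum_(i < d) partial i (cutoff k) x ^+ 2 =
  (2 * d%:R / F) ^+ 2 * (dGamma s0 s1 b k (radial x ^+ 2) * radial x) ^+ 2
    * eucl x ^+ (2 * d - 2).
Proof.
under eq_bigr do rewrite partial_cutoff.
set D := dGamma _ _ _ _ _.
rewrite (eq_bigr (fun i => (2 * d%:R / F * (D * (eucl x ^+ 2) ^+ d.-1)) ^+ 2 * x ord0 i ^+ 2)); last first.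
  by move=> i _; ring.
have key : ((eucl x ^+ 2) ^+ d.-1) ^+ 2 * eucl x ^+ 2 = radial x ^+ 2 * eucl x ^+ (2 * d - 2).
  rewrite /radial -!exprM -!exprD; congr (_ ^+ _).
  by case: d d0 => // n _; rewrite /=; lia.
rewrite -mulr_sumr -sqr_eucl; move: key; set Q := _ ^+ d.-1; set P := _ ^+ (_ - _) => key.
transitivity ((2 * d%:R / F) ^+ 2 * D ^+ 2 * (Q ^+ 2 * eucl x ^+ 2)); first by ring.
by rewrite key; ring.
Qed.

Lemma sum_sqr_partial_cutoff_le C k x : (forall t : R, dstep t <= C) ->
  \sum_(i < d) partial i (cutoff k) x ^+ 2 <=
  (2 * d%:R / F * C) ^+ 2 * cell_avg s0 s1 b k (radial x) ^+ 2 * eucl x ^+ (2 * d - 2).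
Proof.
move=> dC; rewrite sum_sqr_partial_cutoff ler_wpM2r ?exprn_ge0 ?eucl_ge0//.
rewrite [X in _ <= X * _]exprMn -[leRHS]mulrA; apply: ler_wpM2l; first exact: sqr_ge0.
rewrite -[leRHS]exprMn.
have C0 : 0 <= C by apply: le_trans (dC 0); exact: dstep_ge0.
have A0 := cell_avg_ge0 _ _ s01 b M bM k (radial x).
rewrite ler_pXn2r ?nnegrE//.
- by apply: (dGamma_le _ _ s01 _ _ bM s00) => //; exact: radial_ge0.
- by apply: mulr_ge0 (radial_ge0 x); exact: (dGamma_ge0 _ _ s01 _ _ bM s00).
- exact: mulr_ge0.
Qed.

End radial_cutoff.

(** * Energy bound in the limit of fine grids *)

Section energy_limit.
Context {R : realType} {d : nat} (d0 : (0 < d)%N).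
Local Notation Rd := 'rV[R]_d.
Context (lam : {measure set Rd -> \bar R}) (hlam : is_lebesgue_measure lam).
Context (varphi : Rd -> R).
Context (a : 'I_d -> 'I_d -> Rd -> R) (phi : R -> R) (K : set Rd).
Hypothesis hvarphi_pos : {ae lam, forall x, 0 < varphi x}.
Hypothesis hwell_defined : forall f g : Rd -> R, C0inf f -> C0inf g ->
     forall i j, lam.-integrable setT
       (fun x => (a i j x * partial i f x * partial j g x * varphi x)%:E).
Hypothesis hbound : forall x, ~ K x -> normA a x * varphi x <= phi (eucl x).
Context (r0 r1 : R) (r00 : 0 < r0) (r01 : r0 < r1).
Context (b : R -> R) (M : R).
Hypotheses (mb : measurable_fun setT b) (bM : forall s, 0 <= b s <= M).
Local Notation s0 := (r0 ^+ d).
Local Notation s1 := (r1 ^+ d).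
Local Notation mu := (@lebesgue_measure R).
Local Notation F := (total_mass (d := d) r0 r1 b).
Hypothesis F0 : 0 < F.
Hypothesis c0 : 0 < ball_vol lam.
Hypothesis AK : [set x : Rd | r0 <= eucl x <= r1] `<=` ~` K.
Hypothesis iphi : lam.-integrable [set x : Rd | r0 <= eucl x <= r1]
  (EFin \o (fun x => phi (eucl x))).
Local Notation A := ((radial : Rd -> R) @^-1` `]s0, s1]).
(** Where b is positive this says that b times |x|^(2d-2) max(phi, 0) is at most 1. Written without
    division, it still makes sense where phi <= 0. *)
Hypothesis hb : forall x : Rd, A x ->
  b (radial x) ^+ 2 * (eucl x ^+ (2 * d - 2) * Num.max 0 (phi (eucl x))) <= b (radial x).

Let r10 : 0 < r1. Proof. exact: lt_trans r01. Qed.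
Let s00 : 0 < s0. Proof. by rewrite exprn_gt0. Qed.
Let s01 : s0 < s1.
Proof. by rewrite ltr_pXn2r ?nnegrE ?ltW. Qed.

Let AC : A `<=` [set x : Rd | r0 <= eucl x <= r1].
Proof.
move=> x /=; rewrite in_itv/= /radial => /andP[h1 h2].
move: h2; rewrite ler_pXn2r ?nnegrE ?eucl_ge0 ?(ltW r10)// => ->.
by move: h1; rewrite ltr_pXn2r ?nnegrE ?eucl_ge0 ?(ltW r00)// => /ltW ->.
Qed.

Let mA : measurable A.
Proof. by rewrite -[X in measurable X]setTI; exact: measurable_radial. Qed.

Let mC : measurable [set x : Rd | r0 <= eucl x <= r1].
Proof.
rewrite (_ : [set _ | _] = setT `&` @eucl R d @^-1` `[r0, r1]).
  exact: measurable_eucl.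
by rewrite setTI; apply/seteqP; split => x /=; rewrite in_itv.
Qed.

Let w (x : Rd) : R := eucl x ^+ (2 * d - 2) * Num.max 0 (phi (eucl x)).

Let iphiA : lam.-integrable A (EFin \o (fun x => phi (eucl x))).
Proof. exact: integrableS mC mA AC iphi. Qed.

Let mphiA : measurable_fun A (fun x => phi (eucl x)).
Proof. by apply/measurable_EFinP; exact: measurable_int iphiA. Qed.

Let mw : measurable_fun A w.
Proof.
apply: measurable_funM.
  by apply: measurable_funTS; apply: measurable_funX; exact: measurable_eucl.
by apply: measurable_maxr => //; exact: measurable_cst.
Qed.

Let w0 x : 0 <= w x.
Proof. by rewrite mulr_ge0 ?exprn_ge0 ?eucl_ge0// le_max lexx. Qed.

Let iw : lam.-integrable A (EFin \o w).
Proof.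
apply: (@le_integrable _ _ _ lam A mA _ (fun x => (r1 ^+ (2 * d - 2))%:E * (phi (eucl x))%:E)%E).
- exact/measurable_EFinP.
- move=> x Ax; rewrite /= lee_fin (ger0_norm (w0 x)) /w normrM.
  rewrite ger0_norm ?exprn_ge0 ?(ltW r10)//.
  apply: ler_pM; rewrite ?exprn_ge0 ?eucl_ge0 ?le_max ?lexx//.
    have /andP[_ h] := AC x Ax.
    by rewrite lerXn2r ?nnegrE ?eucl_ge0 ?(ltW r10).
  by rewrite ge_max normr_ge0 ler_norm.
- exact: integrableZl.
Qed.

Let H k (x : Rd) : R := cell_avg s0 s1 b k (radial x) ^+ 2 * w x.
Let Hlim (x : Rd) : R := b (radial x) ^+ 2 * w x.

Let avgM k s : 0 <= cell_avg s0 s1 b k s <= M.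
Proof.
apply/andP; split; first exact: (cell_avg_ge0 _ _ s01 _ _ bM).
exact: (cell_avg_le _ _ s01 _ _ mb bM).
Qed.

Let mH k : measurable_fun A (H k).
Proof.
apply: measurable_funM => //; apply: measurable_funTS; apply: measurable_funX.
by apply: measurableT_comp; [exact: measurable_cell_avg|exact: measurable_radial].
Qed.

Let mbr : measurable_fun A (fun x => b (radial x)).
Proof.
by apply: measurable_funTS; apply: measurableT_comp => //; exact: measurable_radial.
Qed.

Let mHlim : measurable_fun A Hlim.
Proof. by apply: measurable_funM => //; exact: measurable_funX. Qed.

(** The exceptional set of [cvg_cell_avg] is null on the line, hence so is its preimage by [radial],
    thanks to [lam_radial]. *)
Let cvgH : {ae lam, forall x, A x -> (H k x)%:E @[k --> \oo] --> (Hlim x)%:E}.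
Proof.
have [N [mN N0 sN]] := cvg_cell_avg _ _ s01 _ _ mb bM.
exists (radial @^-1` N); split.
- by rewrite -[X in measurable X]setTI; exact: measurable_radial.
- rewrite (lam_radial lam hlam)//.
  rewrite (_ : lebesgue_measure _ = 0%E) ?mule0//.
  by apply: (@subset_measure0 _ _ _ mu _ N) => //; exact: measurableI.
move=> x /= /not_implyP[Ax nx]; apply: sN => /= h; apply: nx.
apply: cvg_EFin; first exact: nearW.
apply: cvgM; last exact: cvg_cst.
under eq_fun do rewrite expr2; rewrite expr2.
by apply: cvgM; apply: h; move: Ax; rewrite /= in_itv.
Qed.

(** The energy is at most (2dC/F)^2 times the integral of [H k]. As the grid is refined this
    integral converges, dominated by M^2 w, to that of [Hlim], which is at most c F with c the
    volume of the unit ball. The factor 2 is the slack that lets a finite k suffice. *)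
Lemma exists_cutoff_energy C : 0 < C -> (forall t : R, dstep t <= C) ->
  exists k, dform lam varphi a (cutoff r0 r1 b k) (cutoff r0 r1 b k) <=
    (2 * d%:R / F * C) ^+ 2 * (2 * (ball_vol lam * F)).
Proof.
move=> C0 dC.
have M0 : 0 <= M by have /andP[h1 h2] := bM 0; exact: le_trans h2.
have [||||| _ _ cvI] := @dominated_convergence _ _ _ lam A mA (fun k => EFin \o H k)
  (EFin \o Hlim) (fun x => (M ^+ 2)%:E * (w x)%:E)%E.
- by move=> k; exact/measurable_EFinP.
- exact/measurable_EFinP.
- exact: cvgH.
- exact: integrableZl.
- apply: aeW => x k Ax; rewrite /= lee_fin /H normrM (ger0_norm (w0 x)) ler_wpM2r//.
  have /andP[h1 h2] := avgM k (radial x).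
  by rewrite ger0_norm ?sqr_ge0// lerXn2r ?nnegrE.
(* Here [hb] bounds the integrand by b(|x|^d), whose integral is c F in radial coordinates. *)
have HlimF : (\int[lam]_(x in A) (EFin \o Hlim) x <= (ball_vol lam * F)%:E)%E.
  apply: (@le_trans _ _ (\int[lam]_(x in A) (b (radial x))%:E)%E).
    apply: ge0_le_integral => //.
    - by move=> x _; rewrite lee_fin mulr_ge0 ?sqr_ge0.
    - exact/measurable_EFinP.
    - exact/measurable_EFinP.
  rewrite (ge0_integral_radial lam hlam _ (EFin \o b))//; last 3 first.
  - by move=> s /=; rewrite !in_itv/= andbT => /andP[/ltW h _]; exact: le_trans (ltW s00) h.
  - by apply/measurable_EFinP; exact: measurable_funTS.
  - by move=> s _ /=; rewrite lee_fin; have /andP[] := bM s.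
  have Ffin : (\int[mu]_(s in `]s0, s1]) (b s)%:E \is a fin_num)%E.
    apply: integrable_fin_num; first exact: measurable_itv.
    by apply: (integrable_itv_b _ _ mb bM _ s0 s1); exact: subset_itv_oc_cc.
  by rewrite EFinM /total_mass /Rintegral [X in (_ <= _ * X)%E]fineK.
have cF0 : 0 < ball_vol lam * F by rewrite mulr_gt0.
(* If every grid gave at least 2 c F, so would the limit, against [HlimF] and c F > 0. *)
have [k Hk] : exists k, (\int[lam]_(x in A) (EFin \o H k) x < (2 * (ball_vol lam * F))%:E)%E.
  apply: contrapT => /forallNP hk.
  have : ((2 * (ball_vol lam * F))%:E <= \int[lam]_(x in A) (EFin \o Hlim) x)%E.
    rewrite -(cvg_lim _ cvI)//; apply: lime_ge; first exact: cvgP cvI.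
    by apply: nearW => k; rewrite leNgt; apply/negP; exact: hk.
  move=> /le_trans /(_ HlimF); rewrite lee_fin; lra.
exists k; rewrite -lee_fin.
apply: (@le_trans _ _ (\int[lam]_(x in A) ((2 * d%:R / F * C) ^+ 2 * H k x)%:E)%E).
  apply: (dform_le lam varphi a phi K) => //.
  - exact: (C0inf_cutoff d0 r0 r1 r00 r01 b M mb bM F0).
  - by apply: subset_trans AK.
  - by apply: measurable_funM => //; exact: mH.
  - by move=> x _; rewrite mulr_ge0 ?sqr_ge0// mulr_ge0 ?sqr_ge0.
  (* Off the shell the cell average is 0, so the bound on the sum of squares makes each partial
     derivative vanish, also on the inner sphere. *)
  - move=> x Ax i.
    have := sum_sqr_partial_cutoff_le d0 r0 r1 r00 r01 b M bM F0 C k x dC.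
    rewrite cell_avg_out// ?expr0n ?mulr0 ?mul0r => [h|]; last by move: Ax => /negP; rewrite /= in_itv.
    have : partial i (cutoff r0 r1 b k) x ^+ 2 <= 0.
      by apply: le_trans h; rewrite (bigD1 i)//= lerDl sumr_ge0// => j _; exact: sqr_ge0.
    by rewrite real_exprn_even_le0 ?num_real//= => /eqP.
  - move=> x Ax.
    have h := sum_sqr_partial_cutoff_le d0 r0 r1 r00 r01 b M bM F0 C k x dC.
    have m0 : 0 <= Num.max 0 (phi (eucl x)) by rewrite le_max lexx.
    by apply: le_trans (ler_wpM2r m0 h) _; rewrite /H /w !mulrA.
under eq_integral do rewrite EFinM.
rewrite ge0_integralZl_EFin ?sqr_ge0//.
- by rewrite [leRHS]EFinM; apply: lee_wpmul2l; rewrite ?lee_fin ?sqr_ge0//; exact: ltW.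
- by move=> x _; rewrite lee_fin mulr_ge0 ?sqr_ge0.
- by apply/measurable_EFinP; exact: mH.
Qed.

End energy_limit.

(** * Cutoffs of small energy *)

Section exists_cutoff.
Context {R : realType} {d : nat} (d0 : (0 < d)%N).
Local Notation Rd := 'rV[R]_d.
Context (phi : R -> R).

(** A measurable right inverse of [radial] on the half-line, running along one axis. Measurability
    is available for phi(|x|) on subsets of R^d and not for phi itself, so densities on the line are
    obtained by composing with this curve. *)
Definition curve (s : R) : Rd := (s `^ (d%:R^-1)) *: e_ (Ordinal d0).

Lemma eucl_curve s : eucl (curve s) = s `^ (d%:R^-1).
Proof.
rewrite euclZ ?powR_ge0// /eucl (bigD1 (Ordinal d0))//= big1 => [|i ij].
  by rewrite !mxE !eqxx expr1n addr0 sqrtr1 mulr1.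
by rewrite !mxE (negbTE ij) andbF expr0n.
Qed.

Lemma eucl_curve_radial (x : Rd) : eucl (curve (radial x)) = eucl x.
Proof.
rewrite eucl_curve /radial -powR_mulrn ?eucl_ge0// -powRrM divff ?powRr1 ?eucl_ge0//.
by rewrite pnatr_eq0 -lt0n.
Qed.

Lemma radial_curve s : 0 <= s -> radial (curve s) = s.
Proof.
move=> s0; rewrite /radial eucl_curve -powR_mulrn ?powR_ge0// -powRrM mulVf ?powRr1//.
by rewrite pnatr_eq0 -lt0n.
Qed.

Lemma measurable_curve : measurable_fun setT curve.
Proof.
apply: measurable_fun_rV => i.
under eq_fun do rewrite mxE.
by apply: measurable_funM => //; exact: measurable_powR.
Qed.

(* The regularization of phi bounds [dens m] away from the origin, and makes it
   increase to the integrand [dens_lim] of [a_seq], including where phi <= 0. *)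
Definition dens m (x : Rd) : R :=
  eucl x ^- (2 * d - 2) / (Num.max 0 (phi (eucl x)) + m.+1%:R^-1).

Definition dens_lim (x : Rd) : \bar R :=
  if 0 < phi (eucl x) then (eucl x ^- (2 * d - 2) / phi (eucl x))%:E else +oo%E.

Let den_gt0 m (x : Rd) : 0 < Num.max 0 (phi (eucl x)) + m.+1%:R^-1.
Proof. by rewrite ltr_wpDl ?invr_gt0// le_max lexx. Qed.

Lemma dens_ge0 m x : 0 <= dens m x.
Proof. by apply: divr_ge0; [rewrite invr_ge0 exprn_ge0// eucl_ge0|exact: ltW]. Qed.

Lemma dens_lim_ge0 x : (0 <= dens_lim x)%E.
Proof.
rewrite /dens_lim; case: ifPn => // p0.
by rewrite lee_fin divr_ge0 ?(ltW p0)// invr_ge0 exprn_ge0// eucl_ge0.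
Qed.

Lemma dens_nd m n x : (m <= n)%N -> dens m x <= dens n x.
Proof.
move=> mn; apply: ler_wpM2l; first by rewrite invr_ge0 exprn_ge0// eucl_ge0.
by rewrite lef_pV2 ?posrE// lerD2l lef_pV2 ?posrE// ler_nat.
Qed.

Lemma dens_le m (r : R) x : 0 < r -> r <= eucl x ->
  dens m x <= r ^- (2 * d - 2) * m.+1%:R.
Proof.
move=> r0 rx; apply: ler_pM.
- by rewrite invr_ge0 exprn_ge0// eucl_ge0.
- by rewrite invr_ge0; exact: ltW.
- rewrite lef_pV2 ?posrE ?exprn_gt0// ?(lt_le_trans r0)//.
  by rewrite lerXn2r ?nnegrE ?eucl_ge0 ?(ltW r0).
- rewrite -[leRHS]invrK lef_pV2 ?posrE ?invr_gt0//.
  by rewrite lerDr le_max lexx.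
Qed.

(** With p = max(phi, 0) and e = 1/(m+1), one factor [dens m x] times the weight equals p/(p + e) <=
    1. *)
Lemma dens_sqr_le m x : 0 < eucl x ->
  dens m x ^+ 2 * (eucl x ^+ (2 * d - 2) * Num.max 0 (phi (eucl x))) <= dens m x.
Proof.
move=> x0; have D0 := den_gt0 m x; have q0 : 0 < eucl x ^+ (2 * d - 2) by rewrite exprn_gt0.
rewrite expr2 -mulrA ger_pMr; last by rewrite /dens divr_gt0// invr_gt0.
rewrite /dens; move: D0 q0; set q := _ ^+ _; set p := Num.max _ _; set e := _^-1 => D0 q0.
rewrite (_ : q^-1 / (p + e) * (q * p) = p / (p + e)).
  by rewrite ler_pdivrMr// mul1r lerDl /e invr_ge0.
by field; rewrite !gt_eqF.
Qed.

Lemma cvg_dens x : 0 < eucl x -> (dens m x)%:E @[m --> \oo] --> dens_lim x.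
Proof.
move=> x0; have q0 : 0 < eucl x ^- (2 * d - 2) by rewrite invr_gt0 exprn_gt0.
rewrite /dens_lim /dens; case: ifPn => [p0|]; last rewrite -leNgt => p0.
  apply: cvg_EFin; first exact: nearW.
  rewrite max_r ?(ltW p0)//; apply: cvgM; first exact: cvg_cst.
  apply: cvgV; first by rewrite gt_eqF.
  rewrite -[X in _ --> X]addr0; apply: cvgD; first exact: cvg_cst.
  exact: cvg_harmonic.
rewrite max_l//; apply/cvgeyPge => B; near=> m.
rewrite add0r invrK lee_fin -ler_pdivrMl//.
apply: le_trans (ler_norm _) _; apply: le_trans (ltW (truncnS_gt _)) _.
rewrite ler_nat ltnS; near: m.
exact: nbhs_infty_ge.
Unshelve. all: by end_near. Qed.

Lemma measurable_dens m (A : set Rd) : measurable_fun A (fun x => phi (eucl x)) ->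
  measurable_fun A (dens m).
Proof.
move=> mphi.
(* Inverses are rewritten as powers of exponent -1, so that measurability of real powers applies. *)
rewrite (_ : dens m = (fun x : Rd => (eucl x ^+ (2 * d - 2)) `^ (-1) *
    (Num.max 0 (phi (eucl x)) + m.+1%:R^-1) `^ (-1))); last first.
  by apply/funext => x; rewrite !powR_inv1 ?exprn_ge0 ?eucl_ge0// ltW.
apply: measurable_funM.
  apply: measurable_funTS; apply: (measurableT_comp (measurable_powR _)).
  by apply: measurable_funX; exact: measurable_eucl.
apply: (measurableT_comp (measurable_powR _)).
apply: measurable_funD; last exact: measurable_cst.
by apply: measurable_maxr => //; exact: measurable_cst.
Qed.

Lemma measurable_dens_lim (A : set Rd) : measurable_fun A (fun x => phi (eucl x)) ->
  (forall x, A x -> 0 < eucl x) -> measurable_fun A dens_lim.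
Proof.
move=> mphi A0; apply: (@emeasurable_fun_cvg _ _ _ A (fun m x => (dens m x)%:E)).
  by move=> m; apply/measurable_EFinP; exact: measurable_dens.
by move=> x /A0; exact: cvg_dens.
Qed.

Context (lam : {measure set Rd -> \bar R}) (hlam : is_lebesgue_measure lam).

(** By monotone convergence in m: if all the regularized integrals were at most L, so would be their
    limit. *)
Lemma integral_dens_gt (A : set Rd) (L : R) : measurable A ->
  measurable_fun A (fun x => phi (eucl x)) ->
  (forall x, A x -> 0 < eucl x) -> (L%:E < \int[lam]_(x in A) dens_lim x)%E ->
  exists m, (L%:E < \int[lam]_(x in A) (dens m x)%:E)%E.
Proof.
move=> mA mphi A0 LA; apply: contrapT => /forallNP h.
suff : (\int[lam]_(x in A) dens_lim x <= L%:E)%E by rewrite leNgt LA.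
have cvI := @cvg_monotone_convergence _ _ _ lam A mA (fun m x => (dens m x)%:E) _ _ _.
have -> : (\int[lam]_(x in A) dens_lim x =
    \int[lam]_(x in A) limn (fun m => (dens m x)%:E))%E.
  apply: eq_integral => x; rewrite inE => /A0 x0.
  by apply/esym/cvg_lim => //; exact: cvg_dens.
have {}cvI := cvI (fun m => (measurable_EFinP _ _).2 (measurable_dens m A mphi))
  (fun m x _ => dens_ge0 m x) (fun x _ m n mn => dens_nd m n x mn).
rewrite -(cvg_lim _ cvI)//; apply: lime_le; first exact: cvgP cvI.
by apply: nearW => m; rewrite leNgt; apply/negP; exact: h.
Qed.

End exists_cutoff.

Section exists_low_energy.
Context {R : realType} {d : nat} (d0 : (0 < d)%N).
Local Notation Rd := 'rV[R]_d.
Context (lam : {measure set Rd -> \bar R}) (hlam : is_lebesgue_measure lam).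
Context (varphi : Rd -> R).
Context (a : 'I_d -> 'I_d -> Rd -> R) (phi : R -> R) (K : set Rd).
Hypothesis hvarphi_pos : {ae lam, forall x, 0 < varphi x}.
Hypothesis hwell_defined : forall f g : Rd -> R, C0inf f -> C0inf g ->
     forall i j, lam.-integrable setT
       (fun x => (a i j x * partial i f x * partial j g x * varphi x)%:E).
Hypothesis hphi_loc : loc_integrable_on lam (~` K) (fun x => phi (eucl x)).
Hypothesis hbound : forall x, ~ K x -> normA a x * varphi x <= phi (eucl x).
Context (rho : R) (hrho : 0 < rho) (hKrho : K `<=` [set x | eucl x < rho]).
Hypothesis han_fin : forall n : nat, rho < n%:R -> (a_seq lam phi rho n < +oo)%E.
Hypothesis han_inf : a_seq lam phi rho @ \oo --> +oo%E.

Lemma subset_annulus_setC (r s : R) : rho <= r ->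
  [set x : Rd | r <= eucl x <= s] `<=` ~` K.
Proof.
move=> rr x /= /andP[rx _] /hKrho /=; apply/negP.
by rewrite -leNgt (le_trans rr).
Qed.

Lemma measurable_annulus (r s : R) : measurable [set x : Rd | r <= eucl x <= s].
Proof.
rewrite (_ : [set _ | _] = setT `&` @eucl R d @^-1` `[r, s]).
  exact: measurable_eucl.
by rewrite setTI; apply/seteqP; split => x /=; rewrite in_itv.
Qed.

Lemma integrable_phi_annulus (r s : R) : rho <= r ->
  lam.-integrable [set x : Rd | r <= eucl x <= s] (EFin \o (fun x => phi (eucl x))).
Proof.
move=> rr; apply: hphi_loc; first exact: compact_eucl_itv.
exact: subset_annulus_setC.
Qed.

Lemma measurable_phi_annulus (r s : R) : rho <= r ->
  measurable_fun [set x : Rd | r <= eucl x <= s] (fun x => phi (eucl x)).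
Proof.
by move=> rr; apply/measurable_EFinP; exact: measurable_int (integrable_phi_annulus r s rr).
Qed.

Lemma radial_itv (r s : R) : 0 <= r -> 0 <= s ->
  (radial : Rd -> R) @^-1` `]r ^+ d, s ^+ d] = [set x : Rd | r < eucl x <= s].
Proof.
move=> r0 s0; apply/seteqP; split => x /=; rewrite in_itv/= /radial.
  by rewrite ltr_pXn2r ?nnegrE ?eucl_ge0// ler_pXn2r ?nnegrE ?eucl_ge0.
by rewrite ltr_pXn2r ?nnegrE ?eucl_ge0// ler_pXn2r ?nnegrE ?eucl_ge0.
Qed.

(** The integral over the outer shell is a_s - a_n, where a_n is finite and a_s tends to
    infinity. *)
Lemma a_seq_tail (n : nat) (L : R) : rho < n%:R -> exists2 s : nat, (n < s)%N &
  (L%:E < \int[lam]_(x in ((radial : Rd -> R) @^-1` `]n%:R ^+ d, s%:R ^+ d])%R) dens_lim phi x)%E.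
Proof.
move=> rn.
have [N _ hN] : \forall s \near \oo,
    ((fine (a_seq lam phi rho n) + `|L| + 1)%:E <= a_seq lam phi rho s)%E.
  by move/cvgeyPge : han_inf; exact.
pose s := maxn N n.+1; exists s; first exact: leq_maxr.
have Ns : (N <= s)%N by exact: leq_maxl.
have := hN s Ns.
have aE m : a_seq lam phi rho m =
    (\int[lam]_(x in [set x : Rd | (rho <= eucl x <= m%:R)%R]) dens_lim phi x)%E by [].
have nfin : a_seq lam phi rho n \is a fin_num.
  rewrite ge0_fin_numE; first exact: han_fin.
  by rewrite aE integral_ge0// => x _; exact: dens_lim_ge0.
rewrite radial_itv//.
have ns : n%:R <= s%:R :> R by rewrite ler_nat ltnW// leq_maxr.
have setE : [set x : Rd | rho <= eucl x <= s%:R] =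
    [set x : Rd | rho <= eucl x <= n%:R] `|` [set x : Rd | n%:R < eucl x <= s%:R].
  apply/seteqP; split => x /=.
    by move=> /andP[-> ->]; have [_|] := leP (eucl x) n%:R; [left|right].
  move=> [/andP[-> h]|/andP[h ->]]; first by rewrite (le_trans h).
  by rewrite andbT (le_trans (ltW rn))// ltW.
have mU : measurable [set x : Rd | n%:R < eucl x <= s%:R].
  by rewrite -radial_itv// -[X in measurable X]setTI; exact: measurable_radial.
rewrite (aE s) setE ge0_integral_setU//.
- rewrite -aE -[X in (_ <= X + _)%E -> _](fineK nfin) !EFinD -addeA leeD2lE// => h.
  apply: lt_le_trans h; rewrite -EFinD lte_fin.
  by rewrite (le_lt_trans (ler_norm L))// ltrDl.
- exact: measurable_annulus.
- rewrite -setE; apply: measurable_dens_lim; first exact: measurable_phi_annulus.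
  by move=> x /= /andP[h _]; exact: lt_le_trans h.
- by move=> x _; exact: dens_lim_ge0.
- apply/disj_setPS => x /= [/andP[_ h1] /andP[h2 _]].
  by have := le_lt_trans h1 h2; rewrite ltxx.
Qed.

Lemma exists_low_energy (n : nat) (eps : R) : rho < n%:R -> 0 < eps ->
  exists (s : nat) (u : Rd -> R), [/\ (n < s)%N, C0inf u /\ measurable_fun setT u,
    forall x, 0 <= u x <= 1, (forall x, eucl x <= n%:R -> u x = 1) /\
    (forall x, s%:R <= eucl x -> u x = 0) & dform lam varphi a u u <= eps].
Proof.
move=> rn eps0.
have [C C0 dC] := @dstep_bounded R.
pose c := ball_vol lam.
have c0 : 0 <= c by exact: ball_vol_ge0.
(* The energy bound (2dC/F)^2 (2cF) equals 8 d^2 C^2 c^2/(cF), which is at most eps once cF >= L.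
   The added 1 makes L positive without knowing yet that c > 0. *)
pose L := 8 * d%:R ^+ 2 * C ^+ 2 * c ^+ 2 / eps + 1.
have L0 : 0 < L.
  apply: ltr_wpDl ltr01; apply: divr_ge0 (ltW eps0).
  by do 3 (apply: mulr_ge0; last exact: sqr_ge0).
have [s ns hL] := a_seq_tail n L rn.
have n0 : 0 < n%:R :> R by exact: lt_trans rn.
have nsR : n%:R < s%:R :> R by rewrite ltr_nat.
have s0 : 0 < s%:R :> R by exact: lt_trans nsR.
set A := _ @^-1` _ in hL.
have Apos x : A x -> n%:R < eucl x by rewrite /A radial_itv ?ltW//= => /andP[].
have AC : A `<=` [set x : Rd | n%:R <= eucl x <= s%:R].
  by rewrite /A radial_itv ?ltW// => x /= /andP[/ltW -> ->].
have mA : measurable A by rewrite -[X in measurable X]setTI; exact: measurable_radial.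
have mphi : measurable_fun A (fun x => phi (eucl x)).
  apply: measurable_funS AC _; first exact: measurable_annulus.
  by apply: measurable_phi_annulus; exact: ltW.
have [m hm] := integral_dens_gt phi lam A L mA mphi (fun x Ax => lt_trans n0 (Apos x Ax)) hL.
pose I := `]n%:R ^+ d, s%:R ^+ d]%classic : set R.
(* Restricting to I keeps the density away from the origin, which makes it bounded on the whole
   line. *)
pose b := (fun t => dens phi m (curve d0 t)) \_ I.
have I0 t : I t -> 0 <= t.
  by rewrite /I /= in_itv/= => /andP[/ltW h _]; rewrite (le_trans _ h)// exprn_ge0.
have curveA t : I t -> A (curve d0 t).
  by move=> It; rewrite /A /= radial_curve//; exact: I0.
have bE x : A x -> b (radial x) = dens phi m x.
  move=> Ax; rewrite /b patchT ?inE//.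
  by rewrite /dens eucl_curve_radial.
have mI : measurable I by exact: measurable_itv.
have mb : measurable_fun setT b.
  apply/(measurable_restrictT _ _).1 => //.
  apply: (@measurable_comp _ _ _ _ _ _ A (dens phi m) I (curve d0)) => //.
  - by move=> _ [t It <-]; exact: curveA.
  - exact: measurable_dens.
  - by apply: measurable_funTS; exact: measurable_curve.
pose M : R := n%:R ^- (2 * d - 2) * m.+1%:R.
have bM t : 0 <= b t <= M.
  have M0 : 0 <= M by rewrite mulr_ge0// invr_ge0 exprn_ge0.
  rewrite /b /patch; case: ifPn => [|_]; last by rewrite lexx.
  rewrite inE => It; rewrite dens_ge0 dens_le//.
  exact/ltW/Apos/curveA.
(* In radial coordinates cF is the integral of [dens phi m] over the shell. *)
have cF : L < c * total_mass (d := d) n%:R s%:R b.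
  rewrite -lte_fin; apply: lt_le_trans hm _.
  rewrite (_ : (\int[lam]_(x in A) (dens phi m x)%:E =
      \int[lam]_(x in A) (b (radial x))%:E)%E); last first.
    by apply: eq_integral => x; rewrite inE => Ax; rewrite bE.
  rewrite (ge0_integral_radial lam hlam I (EFin \o b))//.
  - have Ffin : (\int[lebesgue_measure]_(t in I) (b t)%:E \is a fin_num)%E.
      apply: integrable_fin_num => //.
      by apply: (integrable_itv_b _ _ mb bM _ (n%:R ^+ d) (s%:R ^+ d)); exact: subset_itv_oc_cc.
    by rewrite EFinM /total_mass /Rintegral [X in (_ <= _ * X)%E]fineK.
  - by move=> t It; rewrite /= in_itv/= andbT; exact: I0.
  - by apply/measurable_EFinP; exact: measurable_funTS.
  - by move=> t _; rewrite /= lee_fin; have /andP[] := bM t.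
set F := total_mass _ _ _ in cF.
have cF0 : 0 < c * F by exact: lt_trans cF.
have F_ge0 : 0 <= F by apply: Rintegral_ge0 => t _; have /andP[] := bM t.
(* Both c and F are nonnegative with positive product, so each is positive. *)
have [cN0 FN0] : c != 0 /\ F != 0.
  by move: cF0; rewrite lt0r mulf_eq0 negb_or => /andP[/andP[]].
have cpos : 0 < c by rewrite lt0r cN0.
have F0 : 0 < F by rewrite lt0r FN0.
have hb x : A x -> b (radial x) ^+ 2 *
    (eucl x ^+ (2 * d - 2) * Num.max 0 (phi (eucl x))) <= b (radial x).
  by move=> Ax; rewrite bE// dens_sqr_le// (lt_trans n0)// Apos.
have [k hk] := exists_cutoff_energy d0 lam hlam varphi a phi K hvarphi_pos hwell_defined
  hbound n%:R s%:R n0 nsR b M mb bM F0 cpos (subset_annulus_setC _ _ (ltW rn))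
  (integrable_phi_annulus _ _ (ltW rn))
  hb C C0 dC.
exists s, (cutoff n%:R s%:R b k); split => //.
- split; first exact: (C0inf_cutoff d0 _ _ n0 nsR b M mb bM F0).
  exact: measurable_cutoff.
- exact: (cutoff_itv d0 _ _ n0 nsR b M mb bM F0).
- split => x.
    exact: (cutoff_in d0 _ _ n0 nsR).
  exact: (cutoff_out d0 _ _ n0 nsR b M mb bM F0).
apply: le_trans hk _.
rewrite [leLHS](_ : _ = 8 * d%:R ^+ 2 * C ^+ 2 * c ^+ 2 / (c * F)); last first.
  by rewrite -/c -/F; field; rewrite ?cN0 ?FN0.
rewrite ler_pdivrMr// [leRHS]mulrC -ler_pdivrMr//.
by apply: le_trans (ltW cF); rewrite /L lerDl.
Qed.

End exists_low_energy.

(** * Recurrence from a chain of nested cutoffs *)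

Theorem theorem4p3 (R : realType) (d : nat) (hd : (2 <= d)%N)
  (lam : {measure set 'rV[R]_d -> \bar R}) (hlam : is_lebesgue_measure lam)
  (varphi : 'rV[R]_d -> R)
  (hvarphi_loc : loc_integrable_on lam setT varphi)
  (hvarphi_pos : {ae lam, forall x, 0 < varphi x})
  (a : 'I_d -> 'I_d -> 'rV[R]_d -> R)
  (ha_meas : forall i j, measurable_fun setT (a i j))
  (ha_sym : forall i j, a i j = a j i)
  (hwell_defined : forall f g : 'rV[R]_d -> R, C0inf f -> C0inf g ->
     forall i j, lam.-integrable setT
       (fun x => (a i j x * partial i f x * partial j g x * varphi x)%:E))
  (hpositive : forall f : 'rV[R]_d -> R, C0inf f -> 0 <= dform lam varphi a f f)
  (hclosable : closable lam varphi (dform lam varphi a))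
  (K : set 'rV[R]_d) (hK : compact K)
  (phi : R -> R)
  (hphi_loc : loc_integrable_on lam (~` K) (fun x => phi (eucl x)))
  (hbound : forall x, ~ K x -> normA a x * varphi x <= phi (eucl x))
  (rho : R) (hrho : 0 < rho) (hKrho : K `<=` [set x | eucl x < rho])
  (han_fin : forall n : nat, rho < n%:R -> (a_seq lam phi rho n < +oo)%E)
  (han_inf : a_seq lam phi rho @ \oo --> +oo%E) :
  recurrent lam varphi (dform lam varphi a).
Proof.
have d0 : (0 < d)%N by exact: ltnW.
pose E := dform lam varphi a.
(* Here m sets the energy level 1/(m+1) and n is the inner radius; the pair [su] holds an outer
   radius and a cutoff. *)
pose good (m n : nat) (su : nat * ('rV[R]_d -> R)) := [/\ (n < su.1)%N, C0inf su.2 /\ measurable_fun setT su.2,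
    forall x, 0 <= su.2 x <= 1, (forall x, eucl x <= n%:R -> su.2 x = 1) /\
    (forall x, su.1%:R <= eucl x -> su.2 x = 0) & E su.2 su.2 <= m.+1%:R^-1].
have /choice[next nextP] (mn : nat * nat) : exists su, rho < mn.2%:R -> good mn.1 mn.2 su.
  (* The pair (0, 0) is a dummy value for inner radii not exceeding [rho], which the construction
     never meets. *)
  have [rn|] := pselect (rho < mn.2%:R); last by exists (0%N, fun=> 0).
  have [|s [u Hu]] := exists_low_energy d0 lam hlam varphi a phi K hvarphi_pos
    hwell_defined hphi_loc hbound rho hrho hKrho han_fin han_inf mn.2 (mn.1.+1%:R^-1) rn.
    by rewrite invr_gt0.
  by exists (s, u).
(* The first radius is the least natural number above [rho]; each outer radius then serves as the
   next inner one. *)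
pose radius := fix radius m : nat :=
  if m is m'.+1 then (next (m', radius m')).1 else (Num.truncn rho).+1.
have radius_rho m : rho < (radius m)%:R.
  elim: m => [|m IH]; first exact: truncnS_gt.
  have [h _ _ _ _] := nextP (m, radius m) IH.
  by rewrite (lt_trans IH)// ltr_nat.
pose u m := (next (m, radius m)).2.
have uP m : good m (radius m) (radius m.+1, u m).
  by have := nextP (m, radius m) (radius_rho m); case.
have radius_ge m : (m <= radius m)%N.
  elim: m => // m IH; have [h _ _ _ _] := uP m.
  exact: leq_ltn_trans h.
have partial0 i : partial i (fun=> 0 : R) = (fun=> 0) :> ('rV[R]_d -> R).
  by apply/funext => x; rewrite /partial derive_cst.
have E0 f : E (f \- f) (f \- f) = 0.
  rewrite /E /dform big1// => i _; rewrite big1// => j _.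
  rewrite (_ : f \- f = fun=> 0); last by apply/funext => x /=; rewrite subrr.
  by rewrite !partial0 /Rintegral integral0_eq// => x _; rewrite mulr0 mul0r.
exists u, (fun m => E (u m) (u m)); split; [|split; [|split]].
- move=> m; have [_ [Cu mu] _ _ _] := uP m; split => //.
  (* The constant sequence places [u m] in the domain of the closure with its own energy. *)
  exists (fun=> u m); split => //; split; [|split].
  + rewrite (_ : (fun _ => _) = cst 0%E); first exact: cvg_cst.
    apply/funext => n; rewrite /L2dist2; under eq_integral do rewrite subrr expr0n mul0r.
    by rewrite integral0.
  + by move=> eps eps0; exists 0%N => p q _ _; rewrite (E0 (u m) : dform _ _ _ _ _ = 0).
  + exact: cvg_cst.
- apply: aeW => x m; have [_ _ /(_ x) u01 [_ u_out] _] := uP m; split => //.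
  have [_ _ /(_ x)/andP[u0 _] [u_in _] _] := uP m.+1.
  (* Inside the shared radius the next cutoff is 1, its maximal value; outside it the current one is
     0. *)
  have [xr|xr] := leP (eucl x) (radius m.+1)%:R.
    by rewrite (u_in x xr : u m.+1 x = 1); have /andP[] := u01.
  by rewrite (u_out x (ltW xr) : u m x = 0).
- apply: aeW => x; apply: cvg_near_cst.
  (* Since [radius m] is at least m, the point x ends up where the cutoffs equal 1, so the sequence
     is eventually constant. *)
  near=> m; have [_ _ _ [u_in _] _] := uP m; apply: u_in.
  apply: le_trans (ltW (truncnS_gt _)) _; rewrite ler_nat.
  apply: leq_trans (radius_ge m); near: m; exact: nbhs_infty_ge.
- apply: (squeeze_cvgr (f := fun=> 0) (h := fun m => m.+1%:R^-1)).
  + near=> m; have [_ [Cu _] _ _ Eu] := uP m; rewrite Eu andbT; exact: hpositive.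
  + exact: cvg_cst.
  + exact: cvg_harmonic.
Unshelve. all: by end_near. Qed.
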